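(* Let $1<p<\infty$ and let $f$ be a nonnegative measurable function on $\mathbb{R}_+=(0,+\infty)$. Then $$(p-1)\,\|Hf\|_p \le \|H^*f\|_p\le (p-1)^{1/p}\,\|Hf\|_p \qquad\text{if } 1<p\le 2,$$ and $$(p-1)^{1/p}\,\|Hf\|_p \le \|H^*f\|_p\le (p-1)\,\|Hf\|_p \qquad\text{if } 2\le p<\infty.$$ All constants in these inequalities are the best possible: for each $p$ in the respective range, the constant in the left-hand inequality cannot be replaced by any larger constant, and the constant in the right-hand inequality cannot be replaced by any smaller constant, if the inequality is to hold for all nonnegative measurable functions $f$ on $\mathbb{R}_+$.
   Context: For a nonnegative measurable function $f$ on $\mathbb{R}_+=(0,+\infty)$, the Hardy operator $H$ and its dual $H^*$ are defined for $x>0$ by $$Hf(x)=\frac1x\int_0^x f(t)\,dt,\qquad H^*f(x)=\int_x^\infty \frac{f(t)}{t}\,dt,$$ with values in $[0,+\infty]$. For a nonnegative measurable function $g$ on $\mathbb{R}_+$, $\|g\|_p=\left(\int_0^\infty g(x)^p\,dx\right)^{1/p}\in[0,+\infty]$ denotes the $L^p(\mathbb{R}_+)$-norm with respect to Lebesgue measure. It is not assumed that $f\in L^p(\mathbb{R}_+)$ or that the norms of $Hf$, $H^*f$ are finite; the inequalities are understood in $[0,+\infty]$. *)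

(* Defs.v *)
From HB Require Import structures.
From mathcomp Require Import all_boot all_order all_algebra.
From mathcomp Require Import all_classical all_reals all_analysis.

Set Implicit Arguments.
Unset Strict Implicit.
Unset Printing Implicit Defensive.

Import Order.TTheory GRing.Theory Num.Theory.
Import numFieldNormedType.Exports.

Local Open Scope classical_set_scope.
Local Open Scope ring_scope.

(* The reals with the sigma-algebra of Lebesgue-measurable sets, on which      *)
(* completed_lebesgue_measure lives; the canonical sigma-algebra on R is only  *)
(* the Borel one. The carrier is convertible to R.                             *)
Notation lebesgueTypeR R :=
  (caratheodory_type (wlength (R := R) idfun)^*%mu).

Notation lebesgueR R := (@completed_lebesgue_measure R).

(* Functions on the half-line are total functions on R whose values outside    *)
(* ]0, +oo[ are never used.                                                    *)
Definition half_line (R : realType) : set (lebesgueTypeR R) := `]0, +oo[.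
Arguments half_line : clear implicits.

Definition nonneg_measurable (R : realType) (f : R -> R) : Prop :=
  measurable_fun (half_line R) (f : lebesgueTypeR R -> R) /\
  (forall x, 0 < x -> 0 <= f x).

Definition hardy (R : realType) (f : R -> R) (x : R) : \bar R :=
  ((x^-1)%:E * \int[lebesgueR R]_(t in `]0%R, x[) (f t)%:E)%E.

Definition hardy_dual (R : realType) (f : R -> R) (x : R) : \bar R :=
  (\int[lebesgueR R]_(t in `]x, +oo[) ((f t / t)%R)%:E)%E.

Definition half_line_norm (R : realType) (p : R) (g : R -> \bar R) : \bar R :=
  ((\int[lebesgueR R]_(x in half_line R) (g x `^ p)) `^ p^-1)%E.

(* Main.v *)
(******************************************************************************)
(* Write p = q + 1, h = Hf, g = H^*f and w = h + g. For bounded f supported in *)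
(* a compact subset of ]0, +oo[ one has w' = - h / x, so F = x w^p satisfies   *)
(* F' = w^q (g - q h), and F vanishes at 0 and at +oo. Pointwise, if q <= 1,   *)
(*   g^p - q h^p <= F'   and   p (q / p)^q F' <= g^p - (q h)^p,                *)
(* and both are reversed if q >= 1; integrating over the half-line gives the   *)
(* four inequalities. The general case follows by truncation and monotone      *)
(* convergence. The constant q is attained in the limit by x^(-alpha) on ]0, 1]*)
(* or on [1, +oo[ as alpha tends to 1/p, and q^(1/p) by the indicator of       *)
(* ]1, b] as b tends to 1.                                                     *)
(******************************************************************************)
Require Import Defs.
From HB Require Import structures.
From mathcomp Require Import all_boot all_order all_algebra.
From mathcomp Require Import all_classical all_reals all_analysis.
From mathcomp Require Import measurable_realfun.
From mathcomp Require Import ring lra.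

Import Order.TTheory GRing.Theory Num.Theory.
Import numFieldNormedType.Exports.

Local Open Scope classical_set_scope.
Local Open Scope ring_scope.

(** The p-th powers of g and of a multiple of h differ, with a definite sign, from a multiple of an
    exact derivative whose integral over the half-line is 0. Such a derivative exists because w = h
    + g, seen as a function of 1/x, has slope \int_0^x f: the values of f drop out, so w is
    differentiable everywhere although f is only measurable ([is_derive_average_sum]). Then F = x
    w^p has F' = w^q (g - q h), which involves h and g alone, and the problem becomes two
    inequalities between nonnegative reals: [powR_add_split] for the constant q^(1/p) and
    [powR_sub_mean] for the constant q. Both rest on tangent lines of x^q, concave for q <= 1 and
    convex for q >= 1, so a sign [e] covers the two ranges at once. [integral_le_derive] integrates
    them, and two monotone convergences, [cvg_truncation_integral] inside the operators and
    [cvg_integral_poweR] outside, remove the boundedness of f.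

    The equality cases of the pointwise inequalities predict the extremals. [powR_sub_mean] is an
    equality when g = q h, which is the case for x^(-1/p); this power has infinite norm, so nearby
    exponents are used on one side of 1 ([power_head_norms], [power_tail_norms]). [powR_add_split]
    is an equality when h or g is 0, the situation at every x other than 1 for a point mass at 1,
    which the indicators in [concentrated_function_norms] approximate. *)

(** * Pointwise inequalities between powers *)

(** For q < 1 this is Young's inequality for r^q and 1, with conjugate exponents 1/q and 1/(1 -
    q). *)
Lemma powR_le_tangent (R : realType) (q r : R) : 0 < q -> q <= 1 -> 0 <= r ->
  r `^ q <= 1 + q * (r - 1).
Proof.
move=> q0; rewrite le_eqVlt => /predU1P[->|q1] r0.
  by rewrite powRr1// mul1r addrC subrK.
have := @conjugate_powR R (r `^ q) 1 q^-1 (1 - q)^-1 (powR_ge0 _ _) ler01.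
rewrite !invr_gt0 subr_gt0 !invrK powR1 -powRrM mulfV ?gt_eqF// powRr1//.
rewrite mulr1 mul1r => /(_ q0 q1) H; apply: le_trans (H _) _; first by ring.
by rewrite le_eqVlt; apply/orP; left; apply/eqP; ring.
Qed.

(** Unless the left side is negative, [powR_le_tangent] with exponent 1/q bounds its (1/q)-th power
    by r; raising to the power q concludes. *)
Lemma powR_ge_tangent (R : realType) (q r : R) : 1 <= q -> 0 <= r ->
  1 + q * (r - 1) <= r `^ q.
Proof.
move=> q1 r0; have q0 : 0 < q by exact: lt_le_trans q1.
have [y0|/ltW y0] := leP 0 (1 + q * (r - 1)); last first.
  by apply: le_trans (powR_ge0 _ _).
have := @powR_le_tangent R q^-1 _ _ _ y0.
rewrite invr_gt0 invf_le1// => /(_ q0 q1).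
have -> : 1 + q^-1 * (1 + q * (r - 1) - 1) = r by field; rewrite gt_eqF.
move=> H.
have := ge0_ler_powR (ltW q0) _ _ H.
by rewrite !nnegrE -powRrM mulVf ?gt_eqF// powRr1// => -> //; exact: powR_ge0.
Qed.

Lemma powR_predM (R : realType) (q u : R) : 0 < u ->
  u `^ q = u `^ (q - 1) * u.
Proof.
move=> u0; rewrite -[X in _ = _ * X](powRr1 (ltW u0)) -powRD ?subrK//.
by rewrite (gt_eqF u0) implybT.
Qed.

(* The sign [e] treats the ranges [q <= 1] and [1 <= q] together. *)
Lemma powR_tangent (R : realType) (q e u x : R) :
  0 < q -> 0 <= e * (1 - q) -> 0 < u -> 0 <= x ->
  0 <= e * (u `^ (q - 1) * (q * x + (1 - q) * u) - x `^ q).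
Proof.
move=> q0 he u0 x0.
have -> : x `^ q = u `^ q * (x / u) `^ q.
  by rewrite -powRM ?divr_ge0 ?(ltW u0)// mulrCA mulfV ?gt_eqF// mulr1.
have -> : u `^ q = u `^ (q - 1) * u by exact: powR_predM.
have -> : q * x + (1 - q) * u = u * (1 + q * (x / u - 1)).
  by field; rewrite gt_eqF.
rewrite mulrA -mulrBr mulrCA; apply: mulr_ge0.
  by rewrite mulr_ge0 ?powR_ge0// ltW.
have r0 : 0 <= x / u by rewrite divr_ge0// ltW.
have [q1|q1|q1] := ltgtP q 1.
- rewrite mulr_ge0 ?subr_ge0 ?powR_le_tangent ?(ltW q1)//.
  by rewrite pmulr_lge0 ?subr_gt0 in he.
- rewrite mulr_le0 ?subr_le0 ?powR_ge_tangent ?(ltW q1)//.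
  by rewrite nmulr_lge0 ?subr_lt0 in he.
- by rewrite q1 powRr1// mul1r addrCA subrr addr0 subrr mulr0.
Qed.

Lemma mulr_powR (R : realType) (q x : R) : 0 < q -> 0 <= x ->
  x `^ (q + 1) = x * x `^ q.
Proof.
move=> q0 x0; rewrite -(@mulr_powRB1 _ x (q + 1)) ?addrK//.
by rewrite addr_gt0.
Qed.

(** With a = h and b = g, the factor of [e] is q h^p + F' - g^p. It is the sum of b times the
    tangent bound [T1] for b^q at a + b, and of q a times [T2], which compares a^q with a (a + b)^(q
    - 1). *)
Lemma powR_add_split (R : realType) (q e a b : R) :
  0 < q -> 0 <= e * (1 - q) -> 0 <= a -> 0 <= b ->
  0 <= e * (b * (a + b) `^ q + q * a `^ (q + 1) - b `^ (q + 1)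
            - q * (a * (a + b) `^ q)).
Proof.
move=> q0 he a0 b0.
have [w0|] := ltP 0 (a + b); last first.
  move=> ab; have [-> ->] : a = 0 /\ b = 0 by split; lra.
  by rewrite addr0 !powR0 ?gt_eqF ?addr_gt0// !(mul0r,mulr0,addr0,subrr).
rewrite !mulr_powR//.
have T1 := powR_tangent _ q e _ b q0 he w0 b0.
(* Once a^q is factored out, there remains 1 - (a / (a + b))^(1 - q), whose sign is that of 1 - q or
   zero, because the base is at most 1. *)
have T2 : 0 <= e * (a `^ q - a * (a + b) `^ (q - 1)).
  move: a0; rewrite le_eqVlt => /predU1P[<-|a0].
    by rewrite powR0 ?gt_eqF// mul0r subrr mulr0.
  rewrite mulrC -[X in _ - X * _](mulfVK (lt0r_neq0 (powR_gt0 q a0))).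
  have -> : a / a `^ q = a `^ (1 - q).
    by rewrite powRB ?powRr1 ?(ltW a0)// (gt_eqF a0) implybT.
  set k := a + b in w0 T1 *.
  have -> : a `^ q - a `^ (1 - q) * a `^ q * k `^ (q - 1) =
     a `^ q * (1 - (a / k) `^ (1 - q)).
    rewrite powRM ?(ltW a0) ?invr_ge0 ?(ltW w0)// -(powR_inv1 (ltW w0)).
    by rewrite -powRrM mulN1r opprB; ring.
  rewrite -mulrA mulr_ge0 ?powR_ge0// mulrC.
  have ak : 0 < a / k <= 1.
    by rewrite divr_gt0//= ler_pdivrMr// mul1r /k; lra.
  have [q1|q1|q1] := ltgtP q 1.
  - have e0 : 0 <= e by rewrite pmulr_lge0 ?subr_gt0 in he.
    rewrite mulr_ge0// subr_ge0 -[X in _ <= X](powRr0 (a / k)); apply: ger_powR => //.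
    by rewrite subr_ge0 ltW.
  - have e0 : e <= 0 by rewrite nmulr_lge0 ?subr_lt0 in he.
    rewrite mulr_le0// subr_le0 -[X in X <= _](powRr0 (a / k)); apply: ger_powR => //.
    by rewrite subr_le0 ltW.
  - by rewrite q1 subrr powRr0 subrr mulr0.
have wq : (a + b) `^ q = (a + b) `^ (q - 1) * (a + b) by exact: powR_predM.
have E1 := mulr_ge0 b0 T1; have E2 := mulr_ge0 (mulr_ge0 (ltW q0) a0) T2.
move: (addr_ge0 E1 E2); rewrite wq; congr (0 <= _); ring.
Qed.

(** With s = q h and t = g, the mean u is q / (q + 1) times w, so (t - s) u^q is a multiple of F'.
    The increment t^p - s^p, the integral of p x^q from s to t, is compared with its one-point
    quadrature at u; for q = 1 the two agree. *)
Lemma powR_sub_mean (R : realType) (q e s t u : R) :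
  0 < q -> 0 <= e * (1 - q) -> 0 <= s -> 0 <= t -> (q + 1) * u = s + q * t ->
  0 <= e * (t `^ (q + 1) - s `^ (q + 1) - (q + 1) * ((t - s) * u `^ q)).
Proof.
move=> q0 he s0 t0 us.
have u0 : 0 <= u.
  by rewrite -(@pmulr_rge0 _ (q + 1)) ?us ?addr_gt0// addr_ge0// mulr_ge0// ltW.
move: u0; rewrite le_eqVlt => /predU1P[u0|u0].
  move: us; rewrite -u0 mulr0 => us.
  have qt : 0 <= q * t by rewrite mulr_ge0// ltW.
  have s00 : s = 0 by lra.
  have /eqP : q * t = 0 by lra.
  rewrite mulf_eq0 gt_eqF//= => /eqP ->; rewrite s00.
  by rewrite !powR0 ?gt_eqF ?addr_gt0// !(mulr0,subrr).
rewrite !mulr_powR//.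
have uq : u `^ q = u `^ (q - 1) * u by exact: powR_predM.
have D0 : 0 < (1 - q) * t + q * u.
  rewrite -(@pmulr_rgt0 _ (q + 1)) ?addr_gt0//.
  have -> : (q + 1) * ((1 - q) * t + q * u) = t + q * s.
    by rewrite mulrDr [_ * (q * u)]mulrCA us; ring.
  have [t1|t1] := ltP 0 t; first by rewrite ltr_pwDl// mulr_ge0// ltW.
  have t2 : t = 0 by lra.
  rewrite t2 add0r mulr_gt0//.
  by move: us; rewrite t2 mulr0 addr0 => <-; rewrite mulr_gt0 ?addr_gt0.
(* Bound [s `^ q] by its tangent at [u] and [u `^ q] by its tangent at [t],    *)
(* then clear the denominator [(1 - q) * t + q * u].                           *)
have Ts := powR_tangent _ q e u s q0 he u0 s0.
have Tt : 0 <= e * (t * (t `^ q * ((1 - q) * t + q * u)) - t * (t * u `^ q)).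
  move: t0; rewrite le_eqVlt => /predU1P[<-|t0].
    by rewrite !mul0r subrr mulr0.
  have T := powR_tangent _ q e t u q0 he t0 (ltW u0).
  have tq : t `^ q = t `^ (q - 1) * t by exact: powR_predM.
  have := mulr_ge0 (mulr_ge0 (ltW t0) (ltW t0)) T.
  by rewrite tq; congr (0 <= _); ring.
rewrite -(pmulr_rge0 _ D0).
have E1 := mulr_ge0 (mulr_ge0 (ltW D0) s0) Ts.
(* Subtracting [Tt] and [E1] from [(1 - q) * t + q * u] times the claim leaves exactly this square
   term. *)
have E2 : 0 <= q ^+ 2 * s * u `^ (q - 1) * (t - u) ^+ 2 * (e * (1 - q)).
  apply: mulr_ge0 => //; apply: mulr_ge0; last exact: sqr_ge0.
  apply: mulr_ge0; last exact: powR_ge0.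
  by apply: mulr_ge0 => //; exact: sqr_ge0.
have {}us : s = (q + 1) * u - q * t by rewrite us addrK.
move: (addr_ge0 (addr_ge0 Tt E1) E2).
by congr (0 <= _); move: (s `^ q) => A; rewrite uq us; ring.
Qed.

(** * Abstract primitives and the derivative of the sum of the two averages *)

(* What is needed of [Phi x = \int_0^x f] and [G x = \int_x^oo f t / t] when    *)
(* [0 <= f <= M]; the field [pair_dual_decr] says [G' = - Phi' / x] without     *)
(* requiring [Phi] to be differentiable.                                       *)
Record primitive_pair (R : realType) (M : R) (Phi G : R -> R) : Prop := {
  pair_primitive_ge0 : forall x, 0 < x -> 0 <= Phi x ;
  pair_dual_ge0 : forall x, 0 < x -> 0 <= G x ;
  pair_primitive_incr : forall x y, 0 < x -> x <= y ->
    0 <= Phi y - Phi x <= M * (y - x) ;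
  pair_dual_decr : forall x y, 0 < x -> x <= y ->
    (Phi y - Phi x) / y <= G x - G y <= (Phi y - Phi x) / x }.

Arguments pair_primitive_ge0 {R M Phi G} _ {x}.
Arguments pair_dual_ge0 {R M Phi G} _ {x}.
Arguments pair_primitive_incr {R M Phi G} _ {x y}.
Arguments pair_dual_decr {R M Phi G} _ {x y}.

Definition average_sum (R : realType) (Phi G : R -> R) (x : R) : R :=
  Phi x / x + G x.

Section primitive_pair_theory.
Context {R : realType} {M : R} {Phi G : R -> R}.
Hypothesis PG : primitive_pair R M Phi G.
Local Notation w := (average_sum R Phi G).

(** Adding Phi x / x - Phi y / y to the bounds of [pair_dual_decr] cancels the terms in Phi y on the
    left and those in Phi x on the right. *)
Lemma average_sum_decr x y : 0 < x -> x <= y ->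
  Phi x * (x^-1 - y^-1) <= w x - w y <= Phi y * (x^-1 - y^-1).
Proof.
move=> x0 xy; have := pair_dual_decr PG x0 xy.
rewrite /average_sum => /andP[H1 H2].
by apply/andP; split; lra.
Qed.

Lemma average_sum_ge0 x : 0 < x -> 0 <= w x.
Proof.
move=> x0; apply: addr_ge0; last exact: (pair_dual_ge0 PG x0).
by apply: divr_ge0 (ltW x0); exact: (pair_primitive_ge0 PG x0).
Qed.

(* By [average_sum_decr], [average_sum] has slope [Phi x] as a function of     *)
(* [1 / x]; so it is differentiable everywhere although [Phi x / x] and [G]     *)
(* need not be.                                                                *)
Lemma average_sum_quotient x h : 0 < x -> h != 0 -> 0 < x + h ->
  - (Phi x + M * `|h|) / (x * (x + h)) <= h^-1 * (w (x + h) - w x)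
    <= - (Phi x - M * `|h|) / (x * (x + h)).
Proof.
move=> x0 hn0 xh0.
have xxh : 0 < x * (x + h) by rewrite mulr_gt0.
have E : x^-1 - (x + h)^-1 = h / (x * (x + h)) by field; rewrite !gt_eqF.
rewrite ler_pdivrMr// ler_pdivlMr//.
have [hp|hn|] := ltgtP 0 h; last by move=> h0; rewrite -h0 eqxx in hn0.
- have xh : x <= x + h by rewrite lerDl ltW.
  have /andP[P1 P2] := pair_primitive_incr PG x0 xh.
  have := average_sum_decr _ _ x0 xh.
  rewrite E => /andP[W1 W2].
  rewrite mulrA ler_pdivrMr// in W1; rewrite mulrA ler_pdivlMr// in W2.
  rewrite (_ : x + h - x = h) in P2; last by ring.
  rewrite gtr0_norm//.
  have -> : h^-1 * (w (x + h) - w x) * (x * (x + h)) =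
    ((w (x + h) - w x) * (x * (x + h))) / h.
    by field; rewrite gt_eqF.
  rewrite ler_pdivlMr// ler_pdivrMr//.
  have := ler_wpM2r (ltW hp) P2.
  by move=> P3; apply/andP; split; nra.
- have xh : x + h <= x by rewrite gerDl ltW.
  have /andP[P1 P2] := pair_primitive_incr PG xh0 xh.
  have := average_sum_decr _ _ xh0 xh.
  rewrite -(opprB x^-1) E -mulNr => /andP[W1 W2].
  rewrite mulrA ler_pdivrMr// in W1; rewrite mulrA ler_pdivlMr// in W2.
  rewrite (_ : x - (x + h) = - h) in P2; last by ring.
  have h'0 : 0 < - h by rewrite oppr_gt0.
  rewrite ltr0_norm//.
  have -> : h^-1 * (w (x + h) - w x) * (x * (x + h)) =
    ((w x - w (x + h)) * (x * (x + h))) / - h.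
    by field; rewrite lt_eqF.
  rewrite ler_pdivlMr// ler_pdivrMr//.
  have := ler_wpM2r (ltW h'0) P2.
  by move=> P3; apply/andP; split; nra.
Qed.

(** The two bounds of [average_sum_quotient] differ only through M |h| and have the same limit, so
    the difference quotient is squeezed. *)
Lemma is_derive_average_sum (x : R) : 0 < x ->
  is_derive x (1 : R) w (- Phi x / x ^+ 2).
Proof.
move=> x0.
have cv : h^-1 *: ((w \o shift x) (h *: (1:R)) - w x) @[h --> (0:R)^'] -->
    (- Phi x / x ^+ 2 : R).
  have nz : \forall h \near (0:R)^', h != 0 by exact: nbhs_dnbhs_neq.
  have pos : \forall h \near (0:R)^', 0 < x + h.
    apply: nbhs_dnbhs; exists x => //= h /=; rewrite sub0r normrN => hx.
    by rewrite -ltrBlDl sub0r; move: hx; rewrite ltr_norml => /andP[].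
  have nrm : M * `|h| @[h --> (0:R)^'] --> (0:R).
    rewrite -[X in _ --> X](mulr0 M); apply: cvgM; first exact: cvg_cst.
    rewrite -[X in _ --> X](@normr0 _ R); apply: cvg_norm.
    by apply: cvg_within.
  have den : (x * (x + h))^-1 @[h --> (0:R)^'] --> (x ^+ 2)^-1.
    apply: cvgV; first by rewrite gt_eqF// exprn_gt0.
    rewrite expr2; apply: cvgM; first exact: cvg_cst; rewrite -[X in _ --> X]addr0.
    apply: cvgD; first exact: cvg_cst.
    by apply: cvg_within.
  apply: (squeeze_cvgr (f := fun h => - (Phi x + M * `|h|) / (x * (x + h)))
    (h := fun h => - (Phi x - M * `|h|) / (x * (x + h)))).
  - near=> h; rewrite /= -[h *: _]/(h * 1) mulr1 [h + x]addrC.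
    by apply: average_sum_quotient => //; near: h.
  - apply: cvgM => //; apply: cvgN; rewrite -[X in _ --> X]addr0.
    by apply: cvgD => //; exact: cvg_cst.
  - apply: cvgM => //; apply: cvgN; rewrite -[X in _ --> X]subr0.
    by apply: cvgB => //; exact: cvg_cst.
split; first by apply/cvg_ex; eexists; exact: cv.
by apply: cvg_lim => //; exact: cv.
Unshelve. all: by end_near. Qed.

End primitive_pair_theory.

(** * Continuity of powers, and integration of a derivative over the half-line *)

(** The absolute value is there for continuity at 0: on negative bases [powR] takes a default value
    that does not tend to 0. *)
Lemma continuous_norm_powR (R : realType) (p : R) : 0 < p ->
  continuous (fun y : R => `|y| `^ p).
Proof.
move=> p0 x; have [->|x0] := eqVneq x 0.
  apply/cvgrPdist_lt => e e0; rewrite normr0 powR0 ?gt_eqF//.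
  have d0 : 0 < e `^ p^-1 by exact: powR_gt0.
  exists (e `^ p^-1) => //= y; rewrite /ball_/= !sub0r !normrN => ye.
  rewrite ger0_norm ?powR_ge0//.
  have := gt0_ltr_powR p0 _ _ ye; rewrite !nnegrE -powRrM mulVf ?gt_eqF//.
  by rewrite powRr1 ?(ltW e0)//; apply => //; exact: powR_ge0.
apply: (@continuous_comp _ _ _ (fun y : R => `|y|) (fun y => y `^ p)).
  exact: norm_continuous.
apply/differentiable_continuous/derivable1_diffP.
by apply: derivable_powR; rewrite in_itv/= andbT normr_gt0.
Qed.

Lemma continuous_powR_comp (R : realType) (p : R) (f : R -> R) (x : R) :
  0 < p -> 0 < x -> (forall y, 0 < y -> 0 <= f y) ->
  {for x, continuous f} -> {for x, continuous (fun y => f y `^ p)}.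
Proof.
move=> p0 x0 f0 cf; have xp : \forall y \near x, 0 < y by exact: lt_nbhsr.
have C : {for x, continuous (fun y => `|f y| `^ p)}.
  apply: (@continuous_comp _ _ _ f (fun y => `|y| `^ p)) => //.
  exact: continuous_norm_powR.
rewrite /prop_for /continuous_at (ger0_norm (f0 x x0)) in C *.
apply: cvg_trans C; apply: near_eq_cvg; near=> y.
by rewrite ger0_norm// f0//; near: y.
Unshelve. all: by end_near. Qed.

Section integral_le_derive.
Context {R : realType}.
Local Notation mu := (@lebesgue_measure R).
Variables (c : R) (g1 g2 F F' : R -> R).
Hypothesis dF : forall x : R, 0 < x -> is_derive x (1 : R) F (F' x).
Hypothesis cF' : forall x : R, 0 < x -> {for x, continuous F'}.
Hypothesis cg1 : forall x : R, 0 < x -> {for x, continuous g1}.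
Hypothesis cg2 : forall x : R, 0 < x -> {for x, continuous g2}.
Hypothesis g_le : forall x, 0 < x -> g1 x <= c * g2 x + F' x.

Let within_pos (g : R -> R) (a b : R) : 0 < a ->
  (forall x : R, 0 < x -> {for x, continuous g}) ->
  {within `[a, b], continuous g}.
Proof.
move=> a0 cg; apply/continuous_in_subspaceT => z /[1!inE] /=.
by rewrite in_itv/= => /andP[az _]; apply: cg; exact: lt_le_trans az.
Qed.

Lemma integral_le_derive_segment (a b : R) : 0 < a -> a < b ->
  (\int[mu]_(x in `[a, b]) (g1 x)%:E <=
   c%:E * \int[mu]_(x in `[a, b]) (g2 x)%:E + (F b - F a)%:E)%E.
Proof.
move=> a0 ab.
have intg (g : R -> R) : (forall x : R, 0 < x -> {for x, continuous g}) ->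
    mu.-integrable `[a, b] (EFin \o g).
  move=> cg; apply: continuous_compact_integrable; first exact: segment_compact.
  exact: within_pos.
have cF (x : R) : 0 < x -> {for x, continuous F}.
  by move=> x0; apply/differentiable_continuous/derivable1_diffP; case: (dF x x0).
have FTC : (\int[mu]_(x in `[a, b]) (F' x)%:E = (F b)%:E - (F a)%:E)%E.
  apply: continuous_FTC2 => //.
  - exact: within_pos.
  - split.
    + move=> x; rewrite in_itv/= => /andP[ax _].
      by case: (dF x (lt_trans a0 ax)).
    + by apply: cvg_at_right_filter; exact: cF.
    + by apply: cvg_at_left_filter; apply: cF; exact: lt_trans ab.
  - move=> x; rewrite in_itv/= => /andP[ax _].
    by rewrite derive1E; case: (dF x (lt_trans a0 ax)).
rewrite EFinB -FTC -integralZl//; last exact: (intg g2).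
rewrite -integralD//; last 2 first.
  - by apply: (@integrableZl _ _ _ mu) => //; exact: (intg g2).
  - exact: (intg F').
apply: le_integral => //.
- exact: (intg g1).
- apply: integrableD => //; last exact: (intg F').
  by apply: (@integrableZl _ _ _ mu) => //; exact: (intg g2).
- move=> x; rewrite inE/= in_itv/= => /andP[ax _].
  by rewrite -EFinM -EFinD lee_fin g_le// (lt_le_trans a0).
Qed.

Hypothesis c0 : 0 <= c.
Hypothesis g1_ge0 : forall x, 0 < x -> 0 <= g1 x.
Hypothesis g2_ge0 : forall x, 0 < x -> 0 <= g2 x.
Hypothesis F_infty : F n.+1%:R @[n --> \oo] --> (0 : R).
Hypothesis F_zero : F (n.+1%:R^-1) @[n --> \oo] --> (0 : R).

(** With [n.+2] the segment is nondegenerate already at [n = 0], as [integral_le_derive_segment]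
    requires. *)
Let half_line_cover :
  \bigcup_n `[n.+2%:R^-1, n.+2%:R]%classic = `]0, +oo[%classic :> set R.
Proof.
apply/seteqP; split => x /=.
  move=> [n _] /=; rewrite !in_itv/= andbT => /andP[nx _].
  by apply: lt_le_trans nx; rewrite invr_gt0.
rewrite in_itv/= andbT => x0.
pose n := Num.truncn (Num.max x x^-1).
have m0 : 0 <= Num.max x x^-1 by rewrite le_max (ltW x0).
have := truncnS_gt (Num.max x x^-1); rewrite gt_max -/n => /andP[n1 n2].
have nn : n.+1%:R <= n.+2%:R :> R by rewrite ler_nat.
exists n => //=; rewrite in_itv/=; apply/andP; split; last first.
  by apply: ltW; apply: lt_le_trans nn.
rewrite -[x]invrK lef_pV2 ?posrE ?invr_gt0// ltW//.
exact: lt_le_trans nn.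
Qed.

(** On each segment the derivative contributes only a boundary difference of [F], which tends to 0.
    The left side increases to its integral over the half-line by monotone convergence; on the
    right, the integral of [g2] over a segment is bounded by the whole one. *)
Lemma integral_le_derive :
  (\int[mu]_(x in `]0%R, +oo[) (g1 x)%:E <=
   c%:E * \int[mu]_(x in `]0%R, +oo[) (g2 x)%:E)%E.
Proof.
have mg (g : R -> R) : (forall x : R, 0 < x -> {for x, continuous g}) ->
    measurable_fun (`]0%R, +oo[%classic : set R) (EFin \o g).
  move=> cg; apply/measurable_EFinP; apply: open_continuous_measurable_fun.
    exact: interval_open.
  by move=> x; rewrite inE/= in_itv/= andbT; exact: cg.
have sub n : (`[n.+2%:R^-1, n.+2%:R]%classic : set R) `<=` `]0, +oo[%classic.
  by rewrite -half_line_cover => x nx; exists n.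
pose S n : \bar R :=
  (\int[mu]_(x in `[n.+2%:R^-1%R, n.+2%:R%R]) (g1 x)%:E)%E.
have cS : S n @[n --> \oo] --> (\int[mu]_(x in `]0%R, +oo[) (g1 x)%:E)%E.
  rewrite -half_line_cover; apply: ge0_nondecreasing_set_cvg_integral.
  - apply/nondecreasing_seqP => n; rewrite subsetEset => x /=.
    rewrite !in_itv/= => /andP[nx xn]; apply/andP; split.
      by apply: le_trans nx; rewrite lef_pV2 ?posrE// ler_nat.
    by apply: le_trans xn _; rewrite ler_nat.
  - by move=> n; exact: measurable_itv.
  - by move=> n; apply: measurable_funS (mg _ cg1) => //; exact: sub.
  - by move=> n x /sub /=; rewrite in_itv/= andbT => /g1_ge0; rewrite lee_fin.
have cF0 : (c%:E * \int[mu]_(x in `]0%R, +oo[) (g2 x)%:E +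
    (F n.+2%:R - F (n.+2%:R^-1))%:E)%E @[n --> \oo] -->
    (c%:E * \int[mu]_(x in `]0%R, +oo[) (g2 x)%:E)%E.
  rewrite -[X in _ --> X]adde0; apply: cvgeD.
  - by rewrite fin_num_adde_defl.
  - exact: cvg_cst.
  - apply: cvg_EFin; first by near=> n.
    rewrite -[X in _ --> X](subr0 0); apply: cvgB.
    + by move: F_infty; rewrite -(cvg_shiftS (fun n => F n.+1%:R)).
    + by move: F_zero; rewrite -(cvg_shiftS (fun n => F n.+1%:R^-1)).
rewrite -(cvg_lim _ cS)// -(cvg_lim _ cF0)//.
apply: lee_lim; [by apply/cvg_ex; eexists; exact: cS|by apply/cvg_ex; eexists; exact: cF0|].
near=> n; apply: le_trans.
  apply: integral_le_derive_segment; first by rewrite invr_gt0.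
  by apply: (@lt_trans _ _ 1); rewrite ?invf_lt1 ?ltr1n.
rewrite leeD2r// lee_wpmul2l ?lee_fin//.
apply: ge0_subset_integral => //; first exact: mg.
by move=> x /=; rewrite in_itv/= andbT => /g2_ge0; rewrite lee_fin.
Unshelve. all: by end_near. Qed.

End integral_le_derive.

(** * The four integral inequalities for an abstract pair of primitives *)

Section averages_inequality.
Context {R : realType} {M : R} {Phi G : R -> R}.
Hypothesis PG : primitive_pair R M Phi G.
Variable q : R.
Hypothesis q0 : 0 < q.
Local Notation w := (average_sum R Phi G).
Local Notation mu := (@lebesgue_measure R).

(** The chain rule for w^p requires w > 0; this lemma shows that a zero of w makes F vanish on the
    whole half-line. To the right of a zero, G has nothing left to lose, so Phi cannot grow; to the
    left, Phi is 0 by monotonicity, hence G is constant. *)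
Lemma average_sum_eq0 (x y : R) : 0 < x -> w x = 0 -> 0 < y -> w y = 0.
Proof.
move=> x0 wx y0.
have Px := pair_primitive_ge0 PG x0; have Gx := pair_dual_ge0 PG x0.
have Py := pair_primitive_ge0 PG y0; have Gy := pair_dual_ge0 PG y0.
have Pxx : 0 <= Phi x / x by rewrite divr_ge0// ltW.
have G0 : G x = 0 by move: wx; rewrite /average_sum; lra.
have P0 : Phi x = 0.
  have /eqP : Phi x / x = 0 by move: wx; rewrite /average_sum; lra.
  by rewrite mulf_eq0 invr_eq0 (gt_eqF x0) orbF => /eqP.
have Pyy : 0 <= Phi y / y by rewrite divr_ge0// ltW.
rewrite /average_sum; have [xy|/ltW yx] := leP x y.
  have := pair_dual_decr PG x0 xy; rewrite G0 P0 !subr0 => /andP[H _].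
  by lra.
have := pair_dual_decr PG y0 yx; have := pair_primitive_incr PG y0 yx.
rewrite G0 P0 => /andP[H1 _] /andP[_ H2].
have P'0 : Phi y = 0 by lra.
by move: H2; rewrite P'0 !mul0r subrr mul0r; lra.
Qed.

Let F (x : R) := x * w x `^ (q + 1).
Let F' (x : R) := w x `^ q * (G x - q * (Phi x / x)).

Let dF (x : R) : 0 < x -> is_derive x (1 : R) F (F' x).
Proof.
move=> x0; have := average_sum_ge0 PG x x0; rewrite le_eqVlt => /predU1P[wx|wx].
  have -> : F' x = 0 by rewrite /F' -wx powR0 ?mul0r// gt_eqF.
  apply: (@near_eq_is_derive _ _ _ (cst 0)) => //.
    near=> y; rewrite /F (average_sum_eq0 _ y x0 (esym wx)) ?powR0 ?mulr0//.
      by rewrite gt_eqF ?addr_gt0.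
    by near: y; exact: lt_nbhsr.
have dw := is_derive_average_sum PG x x0.
have dp := @is_derive1_powR R (q + 1) (w x) wx.
have dc := @is_derive1_comp R _ _ x _ _ dp dw.
have di := @is_derive_id R R x 1.
have := @is_deriveM R R _ _ x 1 _ _ di dc.
congr (is_derive _ _ _ _).
rewrite /F' addrK /= /GRing.scale /= (powR_predM _ (q + 1) _ wx) addrK /average_sum.
by field; rewrite gt_eqF.
Unshelve. all: by end_near. Qed.

Let cw (x : R) : 0 < x -> {for x, continuous w}.
Proof.
move=> x0; apply/differentiable_continuous/derivable1_diffP.
by case: (is_derive_average_sum PG x x0).
Qed.

Let cPhi (x : R) : 0 < x -> {for x, continuous (fun x => Phi x / x)}.
Proof.
move=> x0; apply: cvgM; last first.
  by apply: cvgV; [rewrite gt_eqF|exact: cvg_id].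
have nrm : M * `|y - x| @[y --> x] --> (0 : R).
  rewrite -[X in _ --> X](mulr0 M); apply: cvgM; first exact: cvg_cst.
  rewrite -[X in _ --> X](@normr0 _ R); apply: cvg_norm.
  rewrite -[X in _ --> X](subrr x); apply: cvgB; last exact: cvg_cst.
  exact: cvg_id.
apply: (squeeze_cvgr (f := fun y => Phi x - M * `|y - x|)
  (h := fun y => Phi x + M * `|y - x|)).
- have : \forall y \near x, 0 < y by exact: lt_nbhsr.
  apply: filterS => y y0; have [xy|/ltW yx] := leP x y.
    have := pair_primitive_incr PG x0 xy.
    by rewrite ger0_norm ?subr_ge0//; lra.
  have := pair_primitive_incr PG y0 yx.
  by rewrite ler0_norm ?subr_le0//; lra.
- by rewrite -[X in _ --> X]subr0; apply: cvgB => //; exact: cvg_cst.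
- by rewrite -[X in _ --> X]addr0; apply: cvgD => //; exact: cvg_cst.
Qed.

Let cG (x : R) : 0 < x -> {for x, continuous G}.
Proof.
move=> x0; have -> : G = (fun y => w y - Phi y / y).
  by apply/funext => y; rewrite /average_sum addrC addrA addNr add0r.
by apply: cvgB; [exact: cw|exact: cPhi].
Qed.

Let cF' (x : R) : 0 < x -> {for x, continuous F'}.
Proof.
move=> x0; apply: cvgM.
  by apply: continuous_powR_comp => //; [exact: (average_sum_ge0 PG)|exact: cw].
by apply: cvgB; [exact: cG|apply: cvgM; [exact: cvg_cst|exact: cPhi]].
Qed.

Variable K : R.
Hypothesis w_bounded : forall x, 0 < x -> w x <= K.
Hypothesis w_decay : forall x, 0 < x -> w x <= K / x.

Let h0 x : 0 < x -> 0 <= Phi x / x.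
Proof. by move=> x0; rewrite divr_ge0 ?(pair_primitive_ge0 PG x0)// ltW. Qed.

Let K0 : 0 <= K.
Proof. exact: le_trans (average_sum_ge0 PG 1 ltr01) (w_bounded 1 ltr01). Qed.

Let p0 : 0 < q + 1. Proof. by rewrite addr_gt0. Qed.

Let harm : (n.+1%:R^-1 : R) @[n --> \oo] --> (0 : R).
Proof. exact: cvg_harmonic. Qed.

Let F_zero : F (n.+1%:R^-1) @[n --> \oo] --> (0 : R).
Proof.
apply: (squeeze_cvgr (f := fun=> 0) (h := fun n => n.+1%:R^-1 * K `^ (q + 1))).
- near=> n; have n0 : 0 < n.+1%:R^-1 :> R by rewrite invr_gt0.
  rewrite mulr_ge0 ?powR_ge0 ?(ltW n0)//= ler_wpM2l ?(ltW n0)//.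
  apply: ge0_ler_powR; rewrite ?nnegrE ?(ltW p0)//.
    exact: (average_sum_ge0 PG _ n0).
  exact: w_bounded.
- exact: cvg_cst.
- rewrite -[X in _ --> X](mul0r (K `^ (q + 1))).
  by apply: cvgM; [exact: harm|exact: cvg_cst].
Unshelve. all: by end_near. Qed.

(** The decay w <= K / x gives F x <= K^(q + 1) x^(-q). The absolute value in the majorant only fits
    it to [continuous_norm_powR]. *)
Let F_infty : F n.+1%:R @[n --> \oo] --> (0 : R).
Proof.
apply: (squeeze_cvgr (f := fun=> 0)
  (h := fun n => K `^ (q + 1) * `|n.+1%:R^-1| `^ q)).
- near=> n; have n0 : 0 < n.+1%:R :> R by [].
  rewrite mulr_ge0 ?powR_ge0//= ger0_norm ?invr_ge0//.
  have -> : K `^ (q + 1) * n.+1%:R^-1 `^ q =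
      n.+1%:R * (K / n.+1%:R) `^ (q + 1).
    rewrite powRM ?invr_ge0// (mulr_powR _ q n.+1%:R^-1) ?invr_ge0//.
    rewrite [RHS]mulrCA; congr (_ * _).
    by rewrite mulrA mulfV ?mul1r// gt_eqF.
  rewrite ler_wpM2l ?(ltW n0)//.
  apply: ge0_ler_powR; rewrite ?nnegrE ?(ltW p0)//.
  - exact: (average_sum_ge0 PG _ n0).
  - by rewrite divr_ge0.
  - exact: w_decay.
- exact: cvg_cst.
- rewrite -[X in _ --> X](mulr0 (K `^ (q + 1))).
  apply: cvgM; first exact: cvg_cst.
  have := continuous_norm_powR _ q q0 (0 : R).
  rewrite /continuous_at normr0 powR0 ?gt_eqF// => c0.
  exact: (cvg_comp _ _ harm c0).
Unshelve. all: by end_near. Qed.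

(** Since k F vanishes at both ends for every k, the factor k may have either sign; a negative one
    serves when F' has to change sides. *)
Lemma averages_le (k c d : R) (g1 g2 : R -> R) : 0 <= c ->
  (forall x : R, 0 < x -> {for x, continuous g1}) ->
  (forall x : R, 0 < x -> {for x, continuous g2}) ->
  (forall x, 0 < x -> 0 <= g1 x) -> (forall x, 0 < x -> 0 <= g2 x) ->
  (forall x, 0 < x -> g1 x <= c * g2 x + k * F' x) ->
  (\int[mu]_(x in `]0%R, +oo[) (g1 x)%:E
     <= c%:E * \int[mu]_(x in `]0%R, +oo[) (g2 x)%:E)%E.
Proof.
move=> c0 cg1 cg2 g10 g20 g12.
apply: (@integral_le_derive _ c g1 g2 (fun x => k * F x) (fun x => k * F' x)) => //.
- move=> x x0; have := @is_deriveZ R R R F k x 1 _ (dF x x0).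
  by [].
- by move=> x x0; apply: cvgM; [exact: cvg_cst|exact: cF'].
- by rewrite -[X in _ --> X](mulr0 k); apply: cvgM; [exact: cvg_cst|exact: F_infty].
- by rewrite -[X in _ --> X](mulr0 k); apply: cvgM; [exact: cvg_cst|exact: F_zero].
Qed.

Local Notation I := (\int[mu]_(x in `]0%R, +oo[) ((Phi x / x) `^ (q + 1))%:E)%E.
Local Notation J := (\int[mu]_(x in `]0%R, +oo[) (G x `^ (q + 1))%:E)%E.

Lemma continuous_average_powR (x : R) :
  0 < x -> {for x, continuous (fun x => (Phi x / x) `^ (q + 1))}.
Proof. by move=> x0; apply: continuous_powR_comp => //; exact: cPhi. Qed.

Lemma continuous_dual_powR (x : R) :
  0 < x -> {for x, continuous (fun x => G x `^ (q + 1))}.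
Proof.
move=> x0; apply: continuous_powR_comp => //; last exact: cG.
by move=> y; exact: (pair_dual_ge0 PG).
Qed.

Let split_le e x : 0 <= e * (1 - q) -> 0 < x ->
  0 <= e * (q * (Phi x / x) `^ (q + 1) + F' x - G x `^ (q + 1)).
Proof.
move=> he x0.
have := powR_add_split _ q e _ _ q0 he (h0 x x0) (pair_dual_ge0 PG x0).
by congr (0 <= _); rewrite /F' /average_sum; ring.
Qed.

Let mean_le e x : 0 <= e * (1 - q) -> 0 < x ->
  0 <= e * (G x `^ (q + 1) - q `^ (q + 1) * (Phi x / x) `^ (q + 1)
            - (q + 1) * (q / (q + 1)) `^ q * F' x).
Proof.
move=> he x0; have w0 := average_sum_ge0 PG x x0.
have := powR_sub_mean _ q e (q * (Phi x / x)) (G x) (q / (q + 1) * w x) q0 he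
   (mulr_ge0 (ltW q0) (h0 x x0)) (pair_dual_ge0 PG x0).
rewrite (powRM _ (ltW q0) (h0 x x0)) (powRM _ (divr_ge0 (ltW q0) (ltW p0)) w0).
move=> /(_ _); have -> : (q + 1) * (q / (q + 1) * w x) = q * (Phi x / x) + q * G x.
  by rewrite /average_sum; field; rewrite !gt_eqF.
by move=> /(_ erefl); congr (0 <= _); rewrite /F'; ring.
Qed.

(** The factor q comes from [split_le] and turns into the constant q^(1/p) under the p-th root; the
    factor q^(q + 1) comes from [mean_le] and turns into q. *)
Lemma averages_inequality_le1 : q <= 1 ->
  (J <= q%:E * I)%E /\ ((q `^ (q + 1))%:E * I <= J)%E.
Proof.
move=> q1; have he : 0 <= 1 * (1 - q) by rewrite mul1r subr_ge0.
split.
  apply: (averages_le 1) => //; [exact: ltW|exact: continuous_dual_powR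
    |exact: continuous_average_powR|by move=> *; exact: powR_ge0|by move=> *; exact: powR_ge0|].
  by move=> x x0; have := split_le 1 x he x0; lra.
rewrite -lee_pdivlMl ?powR_gt0//.
(* [mean_le] is solved for h^p, so its coefficient of F' gets divided by - q^(q + 1). *)
apply: (averages_le (- ((q `^ (q + 1))^-1 * ((q + 1) * (q / (q + 1)) `^ q)))) => //.
- by rewrite invr_ge0 powR_ge0.
- exact: continuous_average_powR.
- exact: continuous_dual_powR.
- by move=> *; exact: powR_ge0.
- by move=> *; exact: powR_ge0.
- move=> x x0; have m := mean_le 1 x he x0.
  rewrite [leRHS](_ : _ = (q `^ (q + 1))^-1 *
    (G x `^ (q + 1) - (q + 1) * (q / (q + 1)) `^ q * F' x)); last by ring.
  by rewrite ler_pdivlMl ?powR_gt0//; lra.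
Qed.

Lemma averages_inequality_ge1 : 1 <= q ->
  (q%:E * I <= J)%E /\ (J <= (q `^ (q + 1))%:E * I)%E.
Proof.
move=> q1; have he : 0 <= -1 * (1 - q) by rewrite mulN1r opprB subr_ge0.
split.
  rewrite -lee_pdivlMl//.
  apply: (averages_le (- q^-1)) => //.
  - by rewrite invr_ge0 ltW.
  - exact: continuous_average_powR.
  - exact: continuous_dual_powR.
  - by move=> *; exact: powR_ge0.
  - by move=> *; exact: powR_ge0.
  - move=> x x0; have m := split_le (-1) x he x0.
    by rewrite mulNr -mulrBr ler_pdivlMl//; lra.
apply: (averages_le ((q + 1) * (q / (q + 1)) `^ q)) => //.
- by rewrite powR_ge0.
- exact: continuous_dual_powR.
- exact: continuous_average_powR.
- by move=> *; exact: powR_ge0.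
- by move=> *; exact: powR_ge0.
- by move=> x x0; have := mean_le (-1) x he x0; lra.
Qed.

End averages_inequality.

(** * Completed versus Borel Lebesgue measure, and integrals over intervals *)

Section lebesgue_transfer.
Context {R : realType}.

Lemma measurable_lebesgueType (A : set R) :
  measurable A -> measurable (A : set (lebesgueTypeR R)).
Proof. exact: sub_caratheodory. Qed.


Lemma measurable_fun_lebesgueType d (T : measurableType d) (D : set R)
    (f : R -> T) : measurable D ->
  measurable_fun D f -> measurable_fun (D : set (lebesgueTypeR R)) f.
Proof. by move=> mD mf _ B mB; apply: measurable_lebesgueType; exact: mf. Qed.

(** Change of variables along the identity, which is measurable from the Lebesgue to the Borel
    sigma-algebra and pushes the completed measure forward to [lebesgue_measure]. Integrals
    evaluated by the fundamental theorem of calculus are transported this way. *)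
Lemma ge0_integral_lebesgueType (D : set R) (g : R -> \bar R) :
  measurable D -> measurable_fun D g -> (forall x, D x -> 0 <= g x)%E ->
  (\int[lebesgueR R]_(x in D) g x = \int[@lebesgue_measure R]_(x in D) g x)%E.
Proof.
move=> mD mg g0.
have mid : measurable_fun (setT : set (lebesgueTypeR R)) (id : _ -> measurableTypeR R).
  by apply: measurable_fun_lebesgueType => //; exact: measurable_id.
have := ge0_integral_pushforward mid (lebesgueR R) mD mg.
rewrite preimage_id => <-; last by move=> x; rewrite inE; exact: g0.
apply: eq_measure_integral => A mA _; by [].
Qed.

Lemma lebesgue_set1 (x : R) : lebesgueR R [set x] = 0%E.
Proof. exact: (@lebesgue_measure_set1 R x). Qed.

Lemma lebesgue_itv_oc (x y : R) : x <= y -> lebesgueR R `]x, y] = (y - x)%:E.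
Proof.
move=> xy; transitivity (@lebesgue_measure R `]x, y]%classic) => //.
rewrite lebesgue_measure_itv/= lte_fin; case: ltP => [_|yx]; first by rewrite EFinB.
have -> : x = y by apply/le_anti; rewrite xy yx.
by rewrite subrr.
Qed.

Lemma measurable_itv_lebesgueType (i : interval R) :
  measurable ([set` i] : set (lebesgueTypeR R)).
Proof. by apply: measurable_lebesgueType; exact: measurable_itv. Qed.

End lebesgue_transfer.

Section half_line_integrals.
Context {R : realType}.
Local Notation lam := (lebesgueR R).
Implicit Types (f g : R -> R) (x y : R).

Lemma nonneg_measurable_sub f (i : interval R) :
  nonneg_measurable f -> [set` i] `<=` half_line R ->
  measurable_fun ([set` i] : set (lebesgueTypeR R)) (EFin \o f).
Proof.
move=> [mf _] si; apply/measurable_EFinP; apply: measurable_funS mf => //.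
exact: measurable_itv_lebesgueType.
Qed.

Lemma nonneg_measurable_div f :
  nonneg_measurable f -> nonneg_measurable (fun t => f t / t).
Proof.
move=> [mf f0]; split; last by move=> x x0; rewrite divr_ge0 ?f0// ltW.
apply: measurable_funM => //; apply: measurable_fun_lebesgueType.
  exact: measurable_itv.
apply: open_continuous_measurable_fun; first exact: interval_open.
move=> x; rewrite inE /half_line/= in_itv/= andbT => x0.
by apply: inv_continuous; rewrite gt_eqF.
Qed.

Lemma half_line_gt0 x : half_line R x -> 0 < x.
Proof. by rewrite /half_line/= in_itv/= andbT. Qed.

Lemma subset_half_line (c : itv_bound R) (x : R) : 0 <= x ->
  [set` Interval (BRight x) c] `<=` half_line R.
Proof.
by move=> x0 t; rewrite /half_line/= !in_itv/= andbT => /andP[xt _]; exact: le_lt_trans xt.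
Qed.

Lemma ge0_integral_split f x y (c : itv_bound R) :
  nonneg_measurable f -> 0 <= x -> x <= y -> (BRight y <= c)%O ->
  (\int[lam]_(t in [set` Interval (BRight x) c]) (f t)%:E =
   \int[lam]_(t in `]x, y]) (f t)%:E +
   \int[lam]_(t in [set` Interval (BRight y) c]) (f t)%:E)%E.
Proof.
move=> mf x0 xy yc; have xy' : (BRight x <= BRight y)%O by rewrite bnd_simp.
have E := itv_bndbnd_setU xy' yc; rewrite E.
apply: ge0_integral_setU.
- exact: measurable_itv_lebesgueType.
- exact: measurable_itv_lebesgueType.
- rewrite -E; apply: nonneg_measurable_sub => //; exact: subset_half_line.
- move=> t; rewrite -E => /(subset_half_line _ _ x0) /half_line_gt0.
  by rewrite lee_fin; exact: mf.2.
- apply/disj_setPS => t [] /=; rewrite !in_itv/= => /andP[_ ty] /andP[yt _].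
  by have := le_lt_trans ty yt; rewrite ltxx.
Qed.

(** Reconciles the open interval in [hardy] with left-open, right-closed intervals, which
    concatenate without overlap; the endpoint is a null set. *)
Lemma integral_itv_oo_oc f x : nonneg_measurable f -> 0 < x ->
  (\int[lam]_(t in `]0%R, x[) (f t)%:E = \int[lam]_(t in `]0%R, x]) (f t)%:E)%E.
Proof.
move=> mf x0.
have E : `]0, x]%classic = `]0, x[%classic `|` [set x] :> set R.
  apply/seteqP; split => t /=; rewrite !in_itv/=.
    move=> /andP[t0]; rewrite le_eqVlt => /predU1P[->|tx]; first by right.
    by left; rewrite t0.
  by move=> [/andP[-> /ltW]//|->]; rewrite x0 lexx.
have m1 : measurable ([set x] : set (lebesgueTypeR R)).
  by apply: measurable_lebesgueType; exact: measurable_set1.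
have mE := nonneg_measurable_sub f `]0, x] mf (subset_half_line _ _ (lexx 0)).
have f0 t : `]0, x]%classic t -> (0 <= (f t)%:E)%E.
  by move=> /(subset_half_line _ _ (lexx 0)) /half_line_gt0; rewrite lee_fin; exact: mf.2.
have N0 : (\int[lam]_(t in [set x]) (f t)%:E = 0)%E.
  apply: null_set_integral.
  - exact: m1.
  - apply: (measurable_funS _ _ mE); first exact: measurable_itv_lebesgueType.
    by rewrite E; exact: subsetUr.
  - exact: lebesgue_set1.
rewrite E in mE f0 *; apply/esym; apply: etrans.
  apply: (ge0_integral_setU lam _ m1 mE f0); first exact: measurable_itv_lebesgueType.
  apply/disj_setPS => t [] /=; rewrite in_itv/= => /andP[_ +] tx.
  by rewrite tx ltxx.
by rewrite N0 adde0.
Qed.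

Lemma le_integral_itv f g x y : nonneg_measurable f -> nonneg_measurable g ->
  0 <= x -> (forall t, x < t -> t <= y -> f t <= g t) ->
  (\int[lam]_(t in `]x, y]) (f t)%:E <= \int[lam]_(t in `]x, y]) (g t)%:E)%E.
Proof.
move=> mf mg x0 fg; have S := subset_half_line (BRight y) x x0.
apply: ge0_le_integral.
- exact: measurable_itv_lebesgueType.
- move=> t /S /half_line_gt0; rewrite lee_fin; exact: mf.2.
- exact: nonneg_measurable_sub.
- exact: nonneg_measurable_sub.
- by move=> t /=; rewrite in_itv/= lee_fin => /andP[]; exact: fg.
Qed.

Lemma nonneg_measurable_cst (k : R) : 0 <= k -> nonneg_measurable (fun=> k).
Proof. by move=> k0; split => // ; exact: measurable_cst. Qed.

Lemma nonneg_measurableZ f (k : R) : 0 <= k ->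
  nonneg_measurable f -> nonneg_measurable (fun t => k * f t).
Proof.
move=> k0 mf; split; last by move=> x x0; rewrite mulr_ge0 ?mf.2.
by apply: measurable_funM => //; exact: mf.1.
Qed.

Lemma integralZ_itv f (k : R) x y : nonneg_measurable f -> 0 <= k -> 0 <= x ->
  (\int[lam]_(t in `]x, y]) (k * f t)%:E
     = k%:E * \int[lam]_(t in `]x, y]) (f t)%:E)%E.
Proof.
move=> mf k0 x0; have S := subset_half_line (BRight y) x x0.
transitivity (\int[lam]_(t in `]x, y]) (k%:E * (EFin \o f) t))%E.
  by apply: eq_integral => t _; rewrite /= EFinM.
apply: (ge0_integralZl lam _ (nonneg_measurable_sub f `]x, y] mf S)).
- exact: measurable_itv_lebesgueType.
- by move=> t /S /half_line_gt0; rewrite lee_fin; exact: mf.2.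
- by rewrite lee_fin.
Qed.

End half_line_integrals.

(** * Bounded functions supported away from 0 and infinity *)

Definition hardy_primitive {R : realType} (f : R -> R) (x : R) : R :=
  fine (\int[lebesgueR R]_(t in `]0%R, x]) (f t)%:E)%E.

Definition hardy_dual_fine {R : realType} (f : R -> R) (x : R) : R :=
  fine (hardy_dual f x).

Section bounded_function.
Context {R : realType}.
Local Notation lam := (lebesgueR R).
Variables (f : R -> R) (M a b : R).
Hypothesis mf : nonneg_measurable f.
Hypothesis fM : forall x, 0 < x -> f x <= M.
Hypothesis fa : forall x, 0 < x -> x <= a -> f x = 0.
Hypothesis fb : forall x, b < x -> f x = 0.
Hypothesis a0 : 0 < a.

Let M0 : 0 <= M. Proof. exact: le_trans (mf.2 _ a0) (fM _ a0). Qed.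

Let N (x y : R) := fine (\int[lam]_(t in `]x, y]) (f t)%:E)%E.
Let D (x y : R) := fine (\int[lam]_(t in `]x, y]) (f t / t)%:E)%E.
Let mfd := nonneg_measurable_div f mf.

Let integral_ge0_itv (g : R -> R) (c : itv_bound R) x : nonneg_measurable g ->
  0 <= x -> (0 <= \int[lam]_(t in [set` Interval (BRight x) c]) (g t)%:E)%E.
Proof.
move=> mg x0; apply: integral_ge0 => t /(subset_half_line _ _ x0) /half_line_gt0.
by rewrite lee_fin; exact: mg.2.
Qed.

Let le_integral_cst (g : R -> R) (k x y : R) : nonneg_measurable g ->
  0 <= x -> x <= y -> 0 <= k -> (forall t, x < t -> t <= y -> g t <= k) ->
  (\int[lam]_(t in `]x, y]) (g t)%:E <= (k * (y - x))%:E)%E.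
Proof.
move=> mg x0 xy k0 gk; rewrite EFinM -lebesgue_itv_oc//.
rewrite -integral_cst; last exact: measurable_itv_lebesgueType.
exact: (le_integral_itv g (fun=> k) x y mg (nonneg_measurable_cst k k0)).
Qed.

Let NE x y : 0 <= x -> x <= y ->
  (\int[lam]_(t in `]x, y]) (f t)%:E)%E = (N x y)%:E.
Proof.
move=> x0 xy; rewrite fineK// ge0_fin_numE; last exact: integral_ge0_itv.
apply: le_lt_trans (ltry (M * (y - x))); apply: le_integral_cst => //.
by move=> t xt _; apply: fM; exact: le_lt_trans xt.
Qed.

Let N_split x y z : 0 <= x -> x <= y -> y <= z -> N x z = N x y + N y z.
Proof.
move=> x0 xy yz; apply: EFin_inj; rewrite EFinD -!NE//.
- by apply: ge0_integral_split; rewrite ?bnd_simp.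
- exact: le_trans xy.
- exact: le_trans yz.
Qed.

Let N_ge0 x y : 0 <= x -> 0 <= N x y.
Proof. by move=> x0; apply: fine_ge0; exact: integral_ge0_itv. Qed.

Let N_le x y : 0 <= x -> x <= y -> N x y <= M * (y - x).
Proof.
move=> x0 xy; rewrite -lee_fin -NE//; apply: le_integral_cst => //.
by move=> t xt _; apply: fM; exact: le_lt_trans xt.
Qed.

Let DE x y : 0 < x -> x <= y ->
  (\int[lam]_(t in `]x, y]) (f t / t)%:E)%E = (D x y)%:E.
Proof.
move=> x0 xy; rewrite fineK// ge0_fin_numE; last first.
  exact: (integral_ge0_itv (fun t => f t / t) _ _ mfd (ltW x0)).
apply: le_lt_trans (ltry (M / x * (y - x))).
apply: (le_integral_cst (fun t => f t / t)) => //; first exact: ltW.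
  by rewrite divr_ge0// ltW.
move=> t xt _; have t0 := lt_trans x0 xt.
by apply: ler_pM; rewrite ?mf.2 ?invr_ge0 ?fM ?(ltW t0)// lef_pV2 ?posrE// ltW.
Qed.

(** On []x, y]] the weight 1/t lies between 1/y and 1/x; this is the source of [pair_dual_decr]. *)
Let D_bounds x y : 0 < x -> x <= y -> N x y / y <= D x y <= N x y / x.
Proof.
move=> x0 xy; have y0 := lt_le_trans x0 xy.
have mk (k : R) : 0 < k -> nonneg_measurable (fun t => k^-1 * f t).
  by move=> k0; apply: nonneg_measurableZ => //; rewrite invr_ge0 ltW.
have NkE (k : R) : 0 < k ->
    (N x y / k)%:E = (\int[lam]_(t in `]x, y]) (k^-1 * f t)%:E)%E.
  move=> k0; rewrite (integralZ_itv _ _ x y mf _ (ltW x0)) ?invr_ge0 ?(ltW k0)//.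
  by rewrite (NE x y (ltW x0) xy) mulrC.
apply/andP; split; rewrite -lee_fin -(DE x y x0 xy) NkE//.
- apply: (le_integral_itv _ _ x y (mk y y0) mfd (ltW x0)) => t xt ty.
  have t0 := lt_trans x0 xt.
  by rewrite mulrC ler_wpM2l ?mf.2// lef_pV2 ?posrE.
- apply: (le_integral_itv _ _ x y mfd (mk x x0) (ltW x0)) => t xt ty.
  have t0 := lt_trans x0 xt.
  by rewrite [leRHS]mulrC ler_wpM2l ?mf.2// lef_pV2 ?posrE// ltW.
Qed.

Local Notation Phi := (hardy_primitive f).
Local Notation G := (hardy_dual_fine f).

Let PhiE x : Phi x = N 0 x. Proof. by []. Qed.

Let tail0 x : b <= x -> hardy_dual f x = 0%E.
Proof.
move=> bx; rewrite /hardy_dual; apply: integral0_eq => t /=.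
rewrite in_itv/= andbT => xt; rewrite fb ?mul0r//; exact: le_lt_trans xt.
Qed.

Let dual_split x y : 0 < x -> x <= y ->
  hardy_dual f x = ((D x y)%:E + hardy_dual f y)%E.
Proof.
move=> x0 xy; rewrite /hardy_dual -DE//.
by rewrite (@ge0_integral_split _ (fun t => f t / t) x y)// ltW.
Qed.

Lemma hardyE x : 0 < x -> hardy f x = (Phi x / x)%:E.
Proof.
move=> x0; rewrite /hardy integral_itv_oo_oc// NE ?(ltW x0)//.
by rewrite -EFinM mulrC.
Qed.

(** Finiteness follows by splitting at the maximum of [x] and [b]: the integrand is bounded before
    that point and zero after it. *)
Lemma hardy_dualE x : 0 < x -> hardy_dual f x = (G x)%:E.
Proof.
move=> x0; rewrite fineK//.
have xm : x <= Num.max x b by rewrite le_max lexx.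
by rewrite (dual_split x _ x0 xm) tail0 ?adde0// le_max lexx orbT.
Qed.

Lemma hardy_primitive_pair : primitive_pair R M Phi G.
Proof.
split.
- by move=> x _; exact: N_ge0.
- move=> x x0; apply: fine_ge0.
  exact: (integral_ge0_itv (fun t => f t / t) _ _ mfd (ltW x0)).
- move=> x y x0 xy; rewrite !PhiE (N_split 0 x y) ?(ltW x0)// addrAC subrr add0r.
  by rewrite N_ge0 ?(ltW x0)//= N_le// ltW.
- move=> x y x0 xy; rewrite !PhiE (N_split 0 x y) ?(ltW x0)// addrAC subrr add0r.
  have -> : G x - G y = D x y; last exact: D_bounds.
  have y0 := lt_le_trans x0 xy.
  apply: EFin_inj; rewrite EFinB -!hardy_dualE// (dual_split x y)//.
  by rewrite addeK// hardy_dualE.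
Qed.

Lemma hardy_primitive0 : Phi a = 0.
Proof.
rewrite PhiE /N integral0_eq// => t /=; rewrite in_itv/= => /andP[t0 ta].
by rewrite fa.
Qed.

Lemma hardy_dual_fine0 : G b = 0.
Proof. by rewrite /hardy_dual_fine tail0. Qed.

End bounded_function.

(** As Phi a = 0, [average_sum_decr] makes w maximal at a. Up to b this gives x w(x) <= b w(a);
    beyond b, G is 0 and Phi no longer grows, so x w(x) <= Phi b. The witness is a sum of
    nonnegative terms dominating all three bounds. *)
Lemma average_sum_bounds (R : realType) (M a b : R) (Phi G : R -> R) :
  primitive_pair R M Phi G -> 0 < a -> 0 < b -> Phi a = 0 -> G b = 0 ->
  exists K, (forall x, 0 < x -> average_sum R Phi G x <= K) /\
            (forall x, 0 < x -> average_sum R Phi G x <= K / x).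
Proof.
move=> PG a0 b0 Pa Gb; set w := average_sum R Phi G.
have wa x : 0 < x -> w x <= w a.
  move=> x0; have [xa|/ltW ax] := leP x a.
    have /andP[_] := average_sum_decr PG x a x0 xa.
    by rewrite -/w Pa mul0r; lra.
  have /andP[+ _] := average_sum_decr PG a x a0 ax.
  by rewrite -/w Pa mul0r; lra.
have w0 : 0 <= w a := average_sum_ge0 PG a a0.
have P0 : 0 <= Phi b := pair_primitive_ge0 PG b0.
have bw : 0 <= b * w a by rewrite mulr_ge0// ltW.
exists (w a + b * w a + Phi b); split => x x0.
  by have := wa x x0; lra.
rewrite ler_pdivlMr//; have [xb|/ltW bx] := leP x b.
  have : w x * x <= w a * b.
    by apply: ler_pM => //; [exact: average_sum_ge0 PG _ x0|exact: ltW|exact: wa].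
  by lra.
have /andP[H _] := pair_dual_decr PG b0 bx.
have Gx := pair_dual_ge0 PG x0.
have /andP[H' _] := pair_primitive_incr PG b0 bx.
have H'' : 0 <= (Phi x - Phi b) / x by rewrite divr_ge0// ltW.
have Gx0 : G x = 0 by move: H; rewrite Gb; lra.
have : (Phi x - Phi b) / x <= 0 by move: H; rewrite Gb Gx0 subr0.
rewrite ler_pdivrMr// mul0r => PP.
have -> : w x * x = Phi x by rewrite /w /average_sum Gx0 addr0 mulfVK ?gt_eqF.
by lra.
Qed.

Lemma cvg_poweR (R : realType) (p : R) (u : nat -> \bar R) (l : \bar R) :
  0 < p -> (forall n, 0 <= u n)%E -> u n @[n --> \oo] --> l ->
  (u n `^ p)%E @[n --> \oo] --> (l `^ p)%E.
Proof.
move=> p0 u0; case: l => [r| |] ul.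
- have r0 : 0 <= r.
    by rewrite -lee_fin; apply: (cvge_ge _ ul); near=> n.
  have /fine_cvgP[uf ur] := ul.
  rewrite poweR_EFin; apply/fine_cvgP; split.
    by apply: filterS uf => n; exact: fin_num_poweR.
  have c := cvg_comp _ _ ur (continuous_norm_powR _ p p0 r).
  rewrite ger0_norm// in c; apply: cvg_trans c; apply: near_eq_cvg; near=> n.
  by rewrite /= fine_poweR ger0_norm// fine_ge0.
- rewrite poweRyr ?gt_eqF//; apply/cvgeyPge => A.
  have /cvgeyPge/(_ (Num.max A 0 `^ p^-1)) := ul.
  apply: filterS => n An.
  have := gt0_ler_poweR (ltW p0) _ _ An.
  rewrite !in_itv/= !leey !andbT lee_fin powR_ge0 u0 => /(_ isT isT).
  rewrite -powRrM mulVf ?gt_eqF// powRr1 ?le_max ?lexx ?orbT//.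
  by apply: le_trans; rewrite lee_fin le_max lexx.
- have : (0 <= -oo :> \bar R)%E by apply: (cvge_ge _ ul); near=> n.
  by [].
Unshelve. all: by end_near. Qed.

Section bounded_inequality.
Context {R : realType}.
Local Notation lam := (lebesgueR R).
Variables (f : R -> R) (M a b q : R).
Hypothesis mf : nonneg_measurable f.
Hypothesis fM : forall x, 0 < x -> f x <= M.
Hypothesis fa : forall x, 0 < x -> x <= a -> f x = 0.
Hypothesis fb : forall x, b < x -> f x = 0.
Hypothesis a0 : 0 < a.
Hypothesis b0 : 0 < b.
Hypothesis q0 : 0 < q.
Local Notation Phi := (hardy_primitive f).
Local Notation G := (hardy_dual_fine f).

Let PG : primitive_pair R M Phi G.
Proof. exact: (hardy_primitive_pair f M a b). Qed.

Let measurable_continuous (g : R -> R) :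
  (forall x : R, 0 < x -> {for x, continuous g}) ->
  measurable_fun (`]0%R, +oo[%classic : set R) (EFin \o g).
Proof.
move=> cg; apply/measurable_EFinP; apply: open_continuous_measurable_fun.
  exact: interval_open.
by move=> x; rewrite inE/= in_itv/= andbT; exact: cg.
Qed.

(** On the half-line [T] agrees with a continuous, hence Borel, function; this gives its
    measurability and the passage between the two measures. *)
Let transfer (T : R -> \bar R) (g : R -> R) :
  (forall x, 0 < x -> T x = (g x)%:E) -> (forall x, 0 < x -> 0 <= g x) ->
  (forall x : R, 0 < x -> {for x, continuous g}) ->
  measurable_fun (half_line R) T /\
  (\int[lam]_(x in half_line R) T x =
   \int[@lebesgue_measure R]_(x in `]0%R, +oo[) (g x)%:E)%E.
Proof.
move=> Tg g0 cg; have mg := measurable_continuous g cg.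
have Tg' x : x \in half_line R -> T x = (EFin \o g) x.
  by rewrite inE => /half_line_gt0 x0; rewrite /= Tg.
split.
  apply: (@eq_measurable_fun _ _ (lebesgueTypeR R) _ _ (EFin \o g)); first by move=> x /Tg' ->.
  by apply: measurable_fun_lebesgueType => //; exact: measurable_itv.
rewrite (eq_integral _ _ Tg'); apply: ge0_integral_lebesgueType; [exact: measurable_itv|exact: mg|].
by move=> x /half_line_gt0 x0; rewrite lee_fin g0.
Qed.

Let hardy_transfer := transfer (fun x => hardy f x `^ (q + 1))%E
  (fun x => (Phi x / x) `^ (q + 1))
  (fun x x0 => congr1 (fun y => y `^ (q + 1))%E (hardyE f M a mf fM a0 x x0))
  (fun x _ => powR_ge0 _ _) (continuous_average_powR PG q q0).

Let hardy_dual_transfer := transfer (fun x => hardy_dual f x `^ (q + 1))%E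
  (fun x => G x `^ (q + 1))
  (fun x x0 => congr1 (fun y => y `^ (q + 1))%E (hardy_dualE f M a b mf fM fb a0 x x0))
  (fun x _ => powR_ge0 _ _) (continuous_dual_powR PG q q0).

Lemma measurable_hardy_powR :
  measurable_fun (half_line R) (fun x => hardy f x `^ (q + 1))%E.
Proof. exact: hardy_transfer.1. Qed.

Lemma measurable_hardy_dual_powR :
  measurable_fun (half_line R) (fun x => hardy_dual f x `^ (q + 1))%E.
Proof. exact: hardy_dual_transfer.1. Qed.

Local Notation I := (\int[lam]_(x in half_line R) (hardy f x `^ (q + 1)))%E.
Local Notation J := (\int[lam]_(x in half_line R) (hardy_dual f x `^ (q + 1)))%E.

Lemma bounded_inequality :
  (q <= 1 -> (J <= q%:E * I /\ (q `^ (q + 1))%:E * I <= J)%E) /\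
  (1 <= q -> (q%:E * I <= J /\ J <= (q `^ (q + 1))%:E * I)%E).
Proof.
have [K [K1 K2]] := average_sum_bounds R M a b Phi G PG a0 b0
  (hardy_primitive0 f a fa) (hardy_dual_fine0 f b fb).
rewrite hardy_transfer.2 hardy_dual_transfer.2.
split => q1.
  exact: (averages_inequality_le1 PG q q0 K).
exact: (averages_inequality_ge1 PG q q0 K).
Qed.

End bounded_inequality.

(** * Extension to all nonnegative measurable functions by truncation *)

Section truncation.
Context {R : realType}.
Local Notation lam := (lebesgueR R).
Implicit Types (f : R -> R) (x : R) (n : nat).

(** One index cuts the height and both ends of the support, so that [bounded_inequality] applies to
    every term while the sequence stays nondecreasing. *)
Definition truncation f n x : R :=
  \1_(`]n.+2%:R^-1, n.+2%:R]%classic : set R) x * Num.min (f x) n.+2%:R.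

Variable f : R -> R.
Hypothesis mf : nonneg_measurable f.

Lemma truncation_nonneg_measurable n : nonneg_measurable (truncation f n).
Proof.
split; last first.
  by move=> x x0; rewrite mulr_ge0// ?indicE// le_min mf.2/=.
apply: measurable_funM.
  apply: measurable_fun_lebesgueType; first exact: measurable_itv.
  by apply: measurable_indic; exact: measurable_itv.
by apply: measurable_minr; [exact: mf.1|exact: measurable_cst].
Qed.

Lemma truncation_out n x :
  ~~ (n.+2%:R^-1 < x <= n.+2%:R) -> truncation f n x = 0.
Proof.
move=> nx; rewrite /truncation indicE memNset ?mul0r// => /=.
by rewrite in_itv/=; exact/negP.
Qed.

Lemma truncation_in n x : n.+2%:R^-1 < x <= n.+2%:R ->
  truncation f n x = Num.min (f x) n.+2%:R.
Proof. by move=> nx; rewrite /truncation indicE mem_set ?mul1r//= in_itv. Qed.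

Lemma truncation_le n x : 0 < x -> truncation f n x <= n.+2%:R.
Proof.
move=> x0; have [nx|nx] := boolP (n.+2%:R^-1 < x <= n.+2%:R).
  by rewrite truncation_in// ge_min lexx orbT.
by rewrite truncation_out.
Qed.

Lemma truncation_nondecreasing x : 0 < x ->
  {homo (truncation f ^~ x) : m n / (m <= n)%N >-> m <= n}.
Proof.
move=> x0 m n mn; have [mx|mx] := boolP (m.+2%:R^-1 < x <= m.+2%:R); last first.
  by rewrite truncation_out//; exact: (truncation_nonneg_measurable n).2.
have mnR : m.+2%:R <= n.+2%:R :> R by rewrite ler_nat !ltnS.
rewrite !truncation_in//.
  by rewrite le_min !ge_min lexx/= mnR orbT.
move: mx => /andP[m1 m2]; rewrite (le_trans m2)// andbT.
by apply: le_lt_trans m1; rewrite lef_pV2 ?posrE.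
Qed.

Lemma truncation_near x : 0 < x -> \forall n \near \oo, truncation f n x = f x.
Proof.
move=> x0; exists (Num.truncn (Num.max (f x) (Num.max x x^-1))) => // n /= ln.
have := truncnS_gt (Num.max (f x) (Num.max x x^-1)).
rewrite !gt_max => /and3P[H1 H2 H3].
have nn : (Num.truncn (Num.max (f x) (Num.max x x^-1))).+1%:R <= n.+2%:R :> R.
  by rewrite ler_nat ltnS; exact: leqW.
rewrite truncation_in ?min_l//; first exact: ltW (lt_le_trans H1 nn).
rewrite (ltW (lt_le_trans H2 nn)) andbT -[x]invrK ltf_pV2 ?posrE ?invr_gt0//.
exact: lt_le_trans nn.
Qed.

Section weighted_integral.
Variables (i : interval R) (g : R -> R).
Hypothesis si : [set` i] `<=` half_line R.
Hypothesis mg : nonneg_measurable g.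

Let measurable_truncationM n : measurable_fun ([set` i] : set (lebesgueTypeR R))
  (fun t => (truncation f n t * g t)%:E).
Proof.
apply/measurable_EFinP; apply: measurable_funM.
  apply: measurable_funS (truncation_nonneg_measurable n).1 => //.
  exact: measurable_itv_lebesgueType.
by apply: measurable_funS mg.1 => //; exact: measurable_itv_lebesgueType.
Qed.

Let truncationM_ge0 n t : [set` i] t -> (0 <= (truncation f n t * g t)%:E)%E.
Proof.
move=> /si /half_line_gt0 t0; rewrite lee_fin mulr_ge0 ?mg.2//.
exact: (truncation_nonneg_measurable n).2.
Qed.

Let truncationM_nondecreasing t : [set` i] t ->
  {homo (fun n => (truncation f n t * g t)%:E) : m n / (m <= n)%N >-> (m <= n)%E}.
Proof.
move=> /si /half_line_gt0 t0 m n mn; rewrite lee_fin ler_wpM2r ?mg.2//.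
exact: truncation_nondecreasing.
Qed.

(** The weight [g] is 1 for the Hardy operator and 1/t for its dual, so one monotone convergence
    argument serves both. *)
Lemma cvg_truncation_integral :
  (\int[lam]_(t in [set` i]) (truncation f n t * g t)%:E)%E @[n --> \oo] -->
  (\int[lam]_(t in [set` i]) (f t * g t)%:E)%E.
Proof.
have E : (\int[lam]_(t in [set` i]) (f t * g t)%:E =
   \int[lam]_(t in [set` i]) limn (fun n => (truncation f n t * g t)%:E))%E.
  apply: eq_integral => t; rewrite inE => /si /half_line_gt0 t0.
  apply/esym/cvg_lim => //; apply: cvg_near_cst.
  by apply: filterS (truncation_near _ t0) => n ->.
rewrite E; apply: cvg_monotone_convergence.
- exact: measurable_itv_lebesgueType.
- exact: measurable_truncationM.
- exact: truncationM_ge0.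
- exact: truncationM_nondecreasing.
Qed.

Lemma truncation_integral_nondecreasing :
  {homo (fun n => \int[lam]_(t in [set` i]) (truncation f n t * g t)%:E)%E :
    m n / (m <= n)%N >-> (m <= n)%E}.
Proof.
move=> m n mn; apply: ge0_le_integral.
- exact: measurable_itv_lebesgueType.
- exact: truncationM_ge0.
- exact: measurable_truncationM.
- exact: measurable_truncationM.
- by move=> t it; exact: truncationM_nondecreasing.
Qed.

End weighted_integral.

Let mcst1 : nonneg_measurable (fun=> 1 : R).
Proof. exact: nonneg_measurable_cst. Qed.

Let minv : nonneg_measurable (fun t : R => t^-1).
Proof.
have := nonneg_measurable_div _ mcst1.
by congr nonneg_measurable; apply/funext => t; rewrite mul1r.
Qed.

Let sub_oo x : [set` `]0, x[] `<=` half_line R.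
Proof. by move=> t; rewrite /half_line/= !in_itv/= andbT => /andP[]. Qed.

Let sub_y x : 0 < x -> [set` `]x, +oo[] `<=` half_line R.
Proof. by move=> x0; apply: subset_half_line; exact: ltW. Qed.

Let hardyM (h : R -> R) x :
  hardy h x = ((x^-1)%:E * \int[lam]_(t in `]0%R, x[) (h t * 1)%:E)%E.
Proof. by rewrite /hardy; congr (_ * _)%E; apply: eq_integral => t _; rewrite mulr1. Qed.

Lemma cvg_hardy_truncation x : 0 < x ->
  hardy (truncation f n) x @[n --> \oo] --> hardy f x.
Proof.
move=> x0; rewrite hardyM; under eq_fun do rewrite hardyM.
apply: cvgeZl => //; exact: (cvg_truncation_integral `]0, x[ (fun=> 1)).
Qed.

Lemma hardy_truncation_nondecreasing x : 0 < x ->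
  {homo (fun n => hardy (truncation f n) x) : m n / (m <= n)%N >-> (m <= n)%E}.
Proof.
move=> x0 m n mn; rewrite !hardyM lee_wpmul2l ?lee_fin ?invr_ge0 ?(ltW x0)//.
exact: (truncation_integral_nondecreasing `]0, x[ (fun=> 1)).
Qed.

Lemma cvg_hardy_dual_truncation x : 0 < x ->
  hardy_dual (truncation f n) x @[n --> \oo] --> hardy_dual f x.
Proof.
by move=> x0; exact: (cvg_truncation_integral `]x, +oo[ (fun t => t^-1) (sub_y x x0)).
Qed.

Lemma hardy_dual_truncation_nondecreasing x : 0 < x ->
  {homo (fun n => hardy_dual (truncation f n) x) : m n / (m <= n)%N >-> (m <= n)%E}.
Proof.
by move=> x0; exact: (truncation_integral_nondecreasing `]x, +oo[ (fun t => t^-1) (sub_y x x0)).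
Qed.

End truncation.

Lemma hardy_ge0 (R : realType) (f : R -> R) (x : R) :
  nonneg_measurable f -> 0 < x -> (0 <= hardy f x)%E.
Proof.
move=> mf x0; apply: mule_ge0; first by rewrite lee_fin invr_ge0 ltW.
by apply: integral_ge0 => t /=; rewrite in_itv/= => /andP[t0 _]; rewrite lee_fin mf.2.
Qed.

Lemma hardy_dual_ge0 (R : realType) (f : R -> R) (x : R) :
  nonneg_measurable f -> 0 < x -> (0 <= hardy_dual f x)%E.
Proof.
move=> mf x0; apply: integral_ge0 => t /=; rewrite in_itv/= andbT => xt.
have t0 := lt_trans x0 xt.
by rewrite lee_fin divr_ge0 ?mf.2// ltW.
Qed.

(** Monotone convergence for the outer integral. The passage to the limit in an inequality uses the
    convergence on its smaller side and the bound by the limit on its larger side. *)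
Lemma cvg_integral_poweR (R : realType) (p : R) (u : nat -> R -> \bar R)
    (v : R -> \bar R) : 0 < p ->
  (forall n, measurable_fun (half_line R) (fun x => u n x `^ p)%E) ->
  (forall n (x : R), 0 < x -> (0 <= u n x)%E) ->
  (forall x, 0 < x -> {homo u ^~ x : m n / (m <= n)%N >-> (m <= n)%E}) ->
  (forall x, 0 < x -> u n x @[n --> \oo] --> v x) ->
  let I w := (\int[lebesgueR R]_(x in half_line R) (w x `^ p))%E in
  I (u n) @[n --> \oo] --> I v /\ forall n, (I (u n) <= I v)%E.
Proof.
move=> p0 mu u0 ndu uv I.
have nd x : half_line R x ->
    {homo (fun n => u n x `^ p)%E : m n / (m <= n)%N >-> (m <= n)%E}.
  move=> /half_line_gt0 x0 m n mn; apply: gt0_ler_poweR; first exact: ltW.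
  - by rewrite in_itv/= leey u0.
  - by rewrite in_itv/= leey u0.
  - exact: ndu.
have cv : I (u n) @[n --> \oo] --> I v.
  have -> : I v = (\int[lebesgueR R]_(x in half_line R) limn (fun n => u n x `^ p))%E.
    apply: eq_integral => x; rewrite inE => /half_line_gt0 x0.
    apply/esym/cvg_lim => //; apply: cvg_poweR => //; last exact: uv.
    by move=> n; exact: u0.
  apply: cvg_monotone_convergence => //.
  - exact: measurable_itv_lebesgueType.
  - by move=> n x _; exact: poweR_ge0.
have ndI : nondecreasing_seq (fun n => I (u n)).
  move=> k m km; apply: ge0_le_integral => //.
  - exact: measurable_itv_lebesgueType.
  - by move=> x _; exact: poweR_ge0.
  - by move=> x hx; exact: nd.
split=> // n; rewrite -(cvg_lim _ cv)// (cvg_lim _ (ereal_nondecreasing_cvgn ndI))//.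
by apply: ereal_sup_ubound; exists n.
Qed.

Section power_integral_inequality.
Context {R : realType}.
Local Notation lam := (lebesgueR R).
Variables (f : R -> R) (q : R).
Hypothesis mf : nonneg_measurable f.
Hypothesis q0 : 0 < q.
Local Notation I f := (\int[lam]_(x in half_line R) (hardy f x `^ (q + 1)))%E.
Local Notation J f := (\int[lam]_(x in half_line R) (hardy_dual f x `^ (q + 1)))%E.
Local Notation fn := (truncation f).

Let mfn n : nonneg_measurable (fn n). Proof. exact: truncation_nonneg_measurable. Qed.

Let p0 : 0 < q + 1. Proof. by rewrite addr_gt0. Qed.

Let fnM n x : 0 < x -> fn n x <= n.+2%:R. Proof. exact: truncation_le. Qed.

Let fna n x : 0 < x -> x <= n.+2%:R^-1 -> fn n x = 0.
Proof. by move=> _ xn; rewrite truncation_out// negb_and -leNgt xn. Qed.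

Let fnb n x : n.+2%:R < x -> fn n x = 0.
Proof. by move=> xn; rewrite truncation_out// negb_and -!ltNge xn orbT. Qed.

Let an n : 0 < n.+2%:R^-1 :> R. Proof. by rewrite invr_gt0. Qed.

Let measurable_I n :
  measurable_fun (half_line R) (fun x => hardy (fn n) x `^ (q + 1))%E.
Proof.
exact: (measurable_hardy_powR (fn n) n.+2%:R n.+2%:R^-1 n.+2%:R q (mfn n) (fnM n)
  (fnb n) (an n) q0).
Qed.

Let measurable_J n :
  measurable_fun (half_line R) (fun x => hardy_dual (fn n) x `^ (q + 1))%E.
Proof.
exact: (measurable_hardy_dual_powR (fn n) n.+2%:R n.+2%:R^-1 n.+2%:R q (mfn n) (fnM n)
  (fnb n) (an n) q0).
Qed.

Let cvg_I := cvg_integral_poweR R (q + 1) (fun n => hardy (fn n)) (hardy f) p0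
  measurable_I (fun n x x0 => hardy_ge0 R (fn n) x (mfn n) x0)
  (fun x x0 => hardy_truncation_nondecreasing f mf x x0)
  (fun x x0 => cvg_hardy_truncation f mf x x0).

Let cvg_J := cvg_integral_poweR R (q + 1) (fun n => hardy_dual (fn n)) (hardy_dual f) p0
  measurable_J (fun n x x0 => hardy_dual_ge0 R (fn n) x (mfn n) x0)
  (fun x x0 => hardy_dual_truncation_nondecreasing f mf x x0)
  (fun x x0 => cvg_hardy_dual_truncation f mf x x0).

Let bounded n := bounded_inequality (fn n) n.+2%:R n.+2%:R^-1 n.+2%:R q
  (mfn n) (fnM n) (fna n) (fnb n) (an n) (ltr0Sn _ _) q0.

Let to_limit (u v : nat -> \bar R) (c : R) (U V : \bar R) : 0 <= c ->
  u n @[n --> \oo] --> U -> (forall n, (v n <= V)%E) ->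
  (forall n, (u n <= c%:E * v n)%E) -> (U <= c%:E * V)%E.
Proof.
move=> c0 uU vV uv; apply: (cvge_le _ uU); near=> n.
by apply: le_trans (uv n) _; rewrite lee_wpmul2l ?lee_fin.
Unshelve. all: by end_near. Qed.

Let to_limitl (u v : nat -> \bar R) (c : R) (U V : \bar R) :
  u n @[n --> \oo] --> U -> (forall n, (v n <= V)%E) ->
  (forall n, (c%:E * u n <= v n)%E) -> (c%:E * U <= V)%E.
Proof.
move=> uU vV uv; have cU : (c%:E * u n)%E @[n --> \oo] --> (c%:E * U)%E.
  by apply: cvgeZl.
apply: (cvge_le _ cU); near=> n.
exact: le_trans (uv n) _.
Unshelve. all: by end_near. Qed.

Lemma power_integral_inequality :
  (q <= 1 -> (J f <= q%:E * I f /\ (q `^ (q + 1))%:E * I f <= J f)%E) /\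
  (1 <= q -> (q%:E * I f <= J f /\ J f <= (q `^ (q + 1))%:E * I f)%E).
Proof.
split=> q1; split.
- apply: (to_limit _ _ _ _ _ (ltW q0) cvg_J.1 cvg_I.2) => n.
  exact: ((bounded n).1 q1).1.
- apply: (to_limitl _ _ _ _ _ cvg_I.1 cvg_J.2) => n.
  exact: ((bounded n).1 q1).2.
- apply: (to_limitl _ _ _ _ _ cvg_I.1 cvg_J.2) => n.
  exact: ((bounded n).2 q1).1.
- apply: (to_limit _ _ _ _ _ (powR_ge0 _ _) cvg_J.1 cvg_I.2) => n.
  exact: ((bounded n).2 q1).2.
Qed.

(** A pointwise limit of the measurable powers attached to the truncations; the norm comparisons for
    the extremals rely on it. *)
Lemma measurable_hardy_poweR :
  measurable_fun (half_line R) (fun x => hardy f x `^ (q + 1))%E.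
Proof.
apply: (@emeasurable_fun_cvg _ (lebesgueTypeR R) R _
  (fun n x => hardy (fn n) x `^ (q + 1))%E).
  exact: measurable_I.
move=> x /half_line_gt0 x0.
exact: (cvg_poweR _ _ _ _ p0 (fun n => hardy_ge0 R (fn n) x (mfn n) x0)
  (cvg_hardy_truncation f mf x x0)).
Qed.

Lemma measurable_hardy_dual_poweR :
  measurable_fun (half_line R) (fun x => hardy_dual f x `^ (q + 1))%E.
Proof.
apply: (@emeasurable_fun_cvg _ (lebesgueTypeR R) R _
  (fun n x => hardy_dual (fn n) x `^ (q + 1))%E).
  exact: measurable_J.
move=> x /half_line_gt0 x0.
exact: (cvg_poweR _ _ _ _ p0 (fun n => hardy_dual_ge0 R (fn n) x (mfn n) x0)
  (cvg_hardy_dual_truncation f mf x x0)).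
Qed.

End power_integral_inequality.

(** * Integrals of powers and comparison of norms with powers *)

Section power_functions.
Context {R : realType}.
Local Notation mu := (@lebesgue_measure R).

Let derive_pow (c x : R) : 0 < x -> c != -1 ->
  is_derive x (1 : R) (fun x => (c + 1)^-1 * x `^ (c + 1)) (x `^ c).
Proof.
move=> x0 c1; have d := @is_derive1_powR R (c + 1) x x0.
have := @is_deriveZ R R R _ (c + 1)^-1 x 1 _ d.
congr (is_derive _ _ _ _); rewrite addrK /GRing.scale/= mulKf//.
by rewrite addr_eq0.
Qed.

Let cont (c x : R) : 0 < x -> {for x, continuous (fun x => x `^ c)}.
Proof.
move=> x0; apply/differentiable_continuous/derivable1_diffP.
by apply: derivable_powR; rewrite in_itv/= andbT.
Qed.

Lemma integral_powR_tail (a c : R) : 0 < a -> c < -1 ->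
  (\int[mu]_(x in `[a, +oo[) (x `^ c)%:E = (a `^ (c + 1) / - (c + 1))%:E)%E.
Proof.
move=> a0 c1; have cn1 : c != -1 by rewrite lt_eqF.
have cc : 0 < - (c + 1) by lra.
rewrite (@ge0_continuous_FTC2y _ _ (fun x => (c + 1)^-1 * x `^ (c + 1)) a 0).
- by rewrite sub0e -EFinN; congr EFin; field; rewrite lt_eqF//; lra.
- by move=> x _; exact: powR_ge0.
- apply/continuous_in_subspaceT => z /[1!inE] /=; rewrite in_itv/= andbT => az.
  by apply: cont; exact: lt_le_trans az.
- rewrite -[X in _ --> X](mulr0 (c + 1)^-1); apply: cvgM; first exact: cvg_cst.
  apply/cvgrPdist_lt => e e0; near=> x.
  have x0 : 0 < x by near: x; exact: nbhs_pinfty_gt.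
  rewrite sub0r normrN ger0_norm ?powR_ge0//.
  have xe : (e^-1) `^ (- (c + 1))^-1 < x by near: x; apply: nbhs_pinfty_gt; exact: num_real.
  have := gt0_ltr_powR cc _ _ xe; rewrite !nnegrE powR_ge0 (ltW x0) => /(_ isT isT).
  rewrite -powRrM mulVf ?gt_eqF// powRr1 ?invr_ge0 ?(ltW e0)// powRN.
  by rewrite ltf_pV2 ?posrE ?powR_gt0.
- by move=> x ax; case: (derive_pow c x (lt_trans a0 ax) cn1).
- apply: cvg_at_right_filter; apply: cvgM; first exact: cvg_cst.
  exact: (cont (c + 1) a a0).
- move=> x; rewrite in_itv/= andbT => ax; rewrite derive1E.
  by case: (derive_pow c x (lt_trans a0 ax) cn1).
Unshelve. all: by end_near. Qed.

(** The integrand may blow up at 0, so the fundamental theorem is applied on [[E n, a]] and the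
    segments exhaust []0, a]]; the divisor [n.+2] keeps [E n < a] for all [n]. *)
Lemma integral_powR_head (a c : R) : 0 < a -> -1 < c ->
  (\int[mu]_(x in `]0%R, a]) (x `^ c)%:E = (a `^ (c + 1) / (c + 1))%:E)%E.
Proof.
move=> a0 c1; have cn1 : c != -1 by rewrite gt_eqF.
have cc : 0 < c + 1 by lra.
pose E n : R := a / n.+2%:R.
have E0 n : 0 < E n by rewrite divr_gt0.
have Ea n : E n < a by rewrite ltr_pdivrMr// ltr_pMr// ltr1n.
have cont' (x : R) : 0 < x -> {for x, continuous (fun x => (c + 1)^-1 * x `^ (c + 1))}.
  move=> x0; apply/differentiable_continuous/derivable1_diffP.
  by case: (derive_pow c x x0 cn1).
have FTC n : (\int[mu]_(x in `[E n, a]) (x `^ c)%:E =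
    ((c + 1)^-1 * a `^ (c + 1) - (c + 1)^-1 * E n `^ (c + 1))%:E)%E.
  rewrite EFinB; apply: (@continuous_FTC2 R (fun x => x `^ c)
    (fun x => (c + 1)^-1 * x `^ (c + 1))) => //.
  - apply/continuous_in_subspaceT => z /[1!inE] /=; rewrite in_itv/= => /andP[az _].
    by apply: cont; exact: lt_le_trans az.
  - split.
    + move=> x; rewrite in_itv/= => /andP[ax _].
      by case: (derive_pow c x (lt_trans (E0 n) ax) cn1).
    + by apply: cvg_at_right_filter; exact: cont'.
    + by apply: cvg_at_left_filter; exact: cont'.
  - move=> x; rewrite in_itv/= => /andP[ax _]; rewrite derive1E.
    by case: (derive_pow c x (lt_trans (E0 n) ax) cn1).
have cover : \bigcup_n `[E n, a]%classic = `]0, a]%classic :> set R.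
  apply/seteqP; split => x /=.
    move=> [n _] /=; rewrite !in_itv/= => /andP[nx ->]; rewrite andbT.
    exact: lt_le_trans nx.
  rewrite in_itv/= => /andP[x0 xa]; exists (Num.truncn (a / x)) => //=.
  rewrite in_itv/= xa andbT ler_pdivrMr// mulrC -ler_pdivrMr//.
  apply: ltW; apply: lt_le_trans (truncnS_gt _) _.
  by rewrite ler_nat.
have C : (\int[mu]_(x in `[E n, a]) (x `^ c)%:E)%E @[n --> \oo] -->
    (\int[mu]_(x in `]0%R, a]) (x `^ c)%:E)%E.
  rewrite -cover; apply: ge0_nondecreasing_set_cvg_integral.
  - apply/nondecreasing_seqP => n; rewrite subsetEset => x /=.
    rewrite !in_itv/= => /andP[nx ->]; rewrite andbT; apply: le_trans nx.
    by rewrite ler_pM2l// lef_pV2 ?posrE// ler_nat.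
  - by move=> n; exact: measurable_itv.
  - move=> n; apply/measurable_EFinP; apply: measurable_funTS.
    exact: measurable_powR.
  - by move=> n x _; rewrite lee_fin powR_ge0.
rewrite -(cvg_lim _ C)//; apply/cvg_lim => //; under eq_fun do rewrite FTC.
apply: cvg_EFin; first by near=> n.
have -> : a `^ (c + 1) / (c + 1) =
   (c + 1)^-1 * a `^ (c + 1) - (c + 1)^-1 * 0 :> R by rewrite mulr0 subr0 mulrC.
apply: cvgB; first exact: cvg_cst.
apply: cvgM; first exact: cvg_cst.
have En : E n @[n --> \oo] --> (0 : R).
  rewrite -[X in _ --> X](mulr0 a); apply: cvgM; first exact: cvg_cst.
  have := @cvg_harmonic R; rewrite -(cvg_shiftS (fun n => n.+1%:R^-1 : R)).
  by [].
have := cvg_comp _ _ En (continuous_norm_powR _ (c + 1) cc 0).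
rewrite normr0 powR0 ?gt_eqF//; apply: cvg_trans.
apply: near_eq_cvg; near=> n.
by rewrite /= ger0_norm// ltW.
Unshelve. all: by end_near. Qed.

End power_functions.

Lemma ler_poweR (R : realType) (r : R) (x y : \bar R) :
  0 <= r -> (0 <= x)%E -> (x <= y)%E -> (x `^ r <= y `^ r)%E.
Proof.
move=> r0 x0 xy; apply: gt0_ler_poweR => //; rewrite in_itv/= leey andbT//.
exact: le_trans xy.
Qed.

Lemma le_half_line_norm (R : realType) (p c : R) (g h : R -> \bar R) :
  0 < p -> 0 <= c ->
  (\int[lebesgueR R]_(x in half_line R) (g x `^ p) <=
     c%:E * \int[lebesgueR R]_(x in half_line R) (h x `^ p))%E ->
  (half_line_norm p g <= (c `^ p^-1)%:E * half_line_norm p h)%E.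
Proof.
move=> p0 c0 gh; rewrite /half_line_norm -poweR_EFin -poweRM ?lee_fin//.
  apply: ler_poweR gh; first by rewrite invr_ge0 ltW.
  by apply: integral_ge0 => x _; exact: poweR_ge0.
by apply: integral_ge0 => x _; exact: poweR_ge0.
Qed.

Lemma ge_half_line_norm (R : realType) (p c : R) (g h : R -> \bar R) :
  0 < p -> 0 <= c ->
  (c%:E * \int[lebesgueR R]_(x in half_line R) (h x `^ p) <=
     \int[lebesgueR R]_(x in half_line R) (g x `^ p))%E ->
  ((c `^ p^-1)%:E * half_line_norm p h <= half_line_norm p g)%E.
Proof.
move=> p0 c0 gh; have I0 : (0 <= \int[lebesgueR R]_(x in half_line R) (h x `^ p))%E.
  by apply: integral_ge0 => x _; exact: poweR_ge0.
rewrite /half_line_norm -poweR_EFin -poweRM ?lee_fin//.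
by apply: ler_poweR gh; [rewrite invr_ge0 ltW|rewrite mule_ge0// lee_fin].
Qed.

Section power_comparison.
Context {R : realType}.
Variables (p s K V : R) (i : interval R) (g : R -> \bar R).
Hypothesis p0 : 0 < p.
Hypothesis K0 : 0 <= K.
Hypothesis V0 : 0 <= V.
Hypothesis i0 : forall x, x \in i -> 0 < x.
Hypothesis iV : (\int[@lebesgue_measure R]_(x in [set` i]) (x `^ (s * p))%:E = V%:E)%E.
Hypothesis mg : measurable_fun (half_line R) (fun x => g x `^ p)%E.

Let si : [set` i] `<=` half_line R.
Proof. by move=> x /= /i0; rewrite /half_line/= in_itv/= andbT. Qed.

Let mi : measurable ([set` i] : set (lebesgueTypeR R)).
Proof. exact: measurable_itv_lebesgueType. Qed.

Let powE (x : R) : x \in i -> ((K * x `^ s) `^ p)%:E = (K `^ p * x `^ (s * p))%:E.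
Proof. by move=> _; rewrite powRM ?powR_ge0// -powRrM. Qed.

Let mpow : measurable_fun ([set` i] : set R) (fun x => (x `^ (s * p))%:E).
Proof.
by apply/measurable_EFinP; apply: measurable_funTS; exact: measurable_powR.
Qed.

Let mKpow : measurable_fun ([set` i] : set (lebesgueTypeR R))
  (fun x => (K `^ p * x `^ (s * p))%:E).
Proof.
apply: measurable_fun_lebesgueType; first exact: measurable_itv.
by apply/measurable_EFinP; apply: measurable_funM => //; apply/measurable_EFinP.
Qed.

Let intK : (\int[lebesgueR R]_(x in [set` i]) (K `^ p * x `^ (s * p))%:E)%E
  = (K `^ p * V)%:E.
Proof.
rewrite EFinM -iV -(ge0_integral_lebesgueType _ _ _ mpow); last 2 first.
- exact: measurable_itv.
- by move=> x _; rewrite lee_fin powR_ge0.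
transitivity (\int[lebesgueR R]_(x in [set` i]) ((K `^ p)%:E * (x `^ (s * p))%:E))%E.
  by apply: eq_integral => x _; rewrite EFinM.
apply: (ge0_integralZl (lebesgueR R) mi).
- by apply: measurable_fun_lebesgueType; [exact: measurable_itv|exact: mpow].
- by move=> x _; rewrite lee_fin powR_ge0.
- by rewrite lee_fin powR_ge0.
Qed.

Let normE : ((K `^ p * V)%:E `^ p^-1)%E = (K * V `^ p^-1)%:E.
Proof.
by rewrite poweR_EFin powRM ?powR_ge0// -powRrM mulfV ?gt_eqF// powRr1.
Qed.

Let g_ge0 (A : set R) x : A x -> (0 <= g x `^ p)%E.
Proof. by move=> _; exact: poweR_ge0. Qed.

Let mgi : measurable_fun ([set` i] : set (lebesgueTypeR R)) (fun x => g x `^ p)%E.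
Proof. by apply: measurable_funS mg => //; exact: measurable_itv_lebesgueType. Qed.

(** K V^(1/p) is the norm of K x^s on the interval [i], by the hypothesis [iV]. *)
Lemma half_line_norm_ge_pow :
  (forall x, x \in i -> ((K * x `^ s)%:E <= g x)%E) ->
  ((K * V `^ p^-1)%:E <= half_line_norm p g)%E.
Proof.
move=> Kg; rewrite -normE; apply: ler_poweR.
- by rewrite invr_ge0 ltW.
- by rewrite lee_fin mulr_ge0// powR_ge0.
rewrite -intK.
apply: (@le_trans _ _ (\int[lebesgueR R]_(x in [set` i]) (g x `^ p))%E).
  apply: (ge0_le_integral _ mi _ mKpow mgi).
    by move=> x _; rewrite lee_fin mulr_ge0 ?powR_ge0.
  move=> x xi; rewrite -powE// -poweR_EFin; apply: ler_poweR; first exact: ltW.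
    by rewrite lee_fin mulr_ge0// powR_ge0.
  exact: Kg.
exact: (ge0_subset_integral _ mi (measurable_itv_lebesgueType _) mg (g_ge0 _) si).
Qed.

Lemma half_line_norm_le_pow :
  (forall x, x \in i -> (0 <= g x <= (K * x `^ s)%:E)%E) ->
  (forall x, 0 < x -> x \notin i -> g x = 0%E) ->
  (half_line_norm p g <= (K * V `^ p^-1)%:E)%E.
Proof.
move=> gK gi; rewrite -normE; apply: ler_poweR.
- by rewrite invr_ge0 ltW.
- by apply: integral_ge0 => x; exact: g_ge0.
have mD : measurable (half_line R `\` [set` i]).
  by apply: measurableD => //; exact: measurable_itv_lebesgueType.
have E := setDUK si.
have mg' := mg; rewrite -E in mg'.
have -> : (\int[lebesgueR R]_(x in half_line R) (g x `^ p) =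
    \int[lebesgueR R]_(x in [set` i]) (g x `^ p))%E.
  rewrite -{1}E; apply: etrans.
    apply: (ge0_integral_setU (lebesgueR R) mi mD mg' (g_ge0 _)).
    by rewrite disj_set2E setDIK.
  rewrite [X in (_ + X)%E]integral0_eq ?adde0//.
  by move=> x [/half_line_gt0 x0 /negP xi]; rewrite gi// poweR0r// gt_eqF.
rewrite -intK; apply: (ge0_le_integral _ mi (g_ge0 _) mgi mKpow).
move=> x xi; rewrite -powE// -poweR_EFin.
by have /andP[] := gK x xi; apply: ler_poweR; exact: ltW.
Qed.

End power_comparison.

(** * Near-extremals for the constant q^(1/p) *)

Section concentrated_function.
Context {R : realType}.
Variables (b q : R).
Hypothesis b1 : 1 < b.
Hypothesis q0 : 0 < q.

(** Divided by b - 1, this approximates a unit mass at 1, for which h is 1/x beyond 1 and g is 1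
    before 1; the norms of these two are q^(-1/p) and 1. *)
Let f : R -> R := \1_(`]1, b]%classic : set R).

Let b0 : 0 < b. Proof. exact: lt_trans b1. Qed.
Let p0 : 0 < q + 1. Proof. by rewrite addr_gt0. Qed.

Let mf : nonneg_measurable f.
Proof.
split; last by move=> x _; rewrite /f indicE.
apply: measurable_fun_lebesgueType; first exact: measurable_itv.
by apply: measurable_indic; exact: measurable_itv.
Qed.

Let f1 (x : R) : 0 < x -> f x <= 1.
Proof. by move=> _; rewrite /f indicE; case: (_ \in _). Qed.

Let f_out (x : R) : ~~ (1 < x <= b) -> f x = 0.
Proof.
move=> nx; rewrite /f indicE memNset//= in_itv/=; exact/negP.
Qed.

Let fa (x : R) : 0 < x -> x <= 1 -> f x = 0.
Proof. by move=> _ x1; rewrite f_out// negb_and -leNgt x1. Qed.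

Let fb (x : R) : b < x -> f x = 0.
Proof. by move=> bx; rewrite f_out// negb_and -!ltNge bx orbT. Qed.

Local Notation Phi := (hardy_primitive f).
Local Notation G := (hardy_dual_fine f).

Let PG : primitive_pair R 1 Phi G.
Proof. exact: (hardy_primitive_pair f 1 1 b mf f1 fb ltr01). Qed.

Let P1 : Phi 1 = 0. Proof. exact: (hardy_primitive0 f 1 fa). Qed.
Let Gb : G b = 0. Proof. exact: (hardy_dual_fine0 f b fb). Qed.
Let C := Phi b.

Let CE : C = b - 1.
Proof.
rewrite /C /hardy_primitive integral_indic.
- rewrite (_ : _ `&` _ = `]1, b]%classic); first exact:
    (congr1 fine (lebesgue_itv_oc 1 b (ltW b1))).
  apply/seteqP; split => x /=; first by case.
  by rewrite !in_itv/= => /andP[x1 ->]; rewrite x1 (lt_trans _ x1).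
- exact: measurable_itv_lebesgueType.
- exact: measurable_itv_lebesgueType.
Qed.

Let C0 : 0 < C. Proof. by rewrite CE subr_gt0. Qed.

Let Phi_le (x : R) : 0 < x -> Phi x <= C.
Proof.
move=> x0; have [xb|/ltW bx] := leP x b.
  by have := pair_primitive_incr PG x0 xb; rewrite -/C; lra.
(* G is 0 at b and nonnegative afterwards, so [pair_dual_decr] leaves no room for growth of Phi. *)
have /andP[H _] := pair_dual_decr PG b0 bx.
have Gx := pair_dual_ge0 PG x0.
have : (Phi x - Phi b) / x <= 0 by rewrite Gb in H; lra.
by rewrite ler_pdivrMr// mul0r subr_le0.
Qed.

Let Phi_right (x : R) : b <= x -> Phi x = C.
Proof.
move=> bx; have x0 := lt_le_trans b0 bx.
have := pair_primitive_incr PG b0 bx; rewrite -/C.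
by have := Phi_le x x0; lra.
Qed.

Let Phi_left (x : R) : 0 < x -> x <= 1 -> Phi x = 0.
Proof.
move=> x0 x1; have := pair_primitive_incr PG x0 x1.
by have := pair_primitive_ge0 PG x0; rewrite P1; lra.
Qed.

Let G_left (x : R) : 0 < x -> x <= 1 -> G x = G 1.
Proof.
move=> x0 x1; have := pair_dual_decr PG x0 x1.
by rewrite P1 Phi_left// subrr !mul0r; lra.
Qed.

Let G1 : C / b <= G 1 <= C.
Proof.
have := pair_dual_decr PG ltr01 (ltW b1).
by rewrite P1 Gb !subr0 divr1.
Qed.

Let G_right (x : R) : b <= x -> G x = 0.
Proof.
move=> bx; have x0 := lt_le_trans b0 bx.
have := pair_dual_decr PG b0 bx; rewrite Phi_right// subrr !mul0r Gb.
by lra.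
Qed.

Let G_le (x : R) : 0 < x -> G x <= C.
Proof.
move=> x0; have /andP[_ G1C] := G1; have [x1|/ltW x1] := leP x 1.
  by rewrite G_left.
have /andP[H _] := pair_dual_decr PG ltr01 x1.
have /andP[H' _] := pair_primitive_incr PG ltr01 x1.
have : 0 <= (Phi x - Phi 1) / x by rewrite divr_ge0// ltW.
by lra.
Qed.

Let hE (x : R) : 0 < x -> hardy f x = (Phi x / x)%:E.
Proof. exact: (hardyE f 1 1 mf f1 ltr01). Qed.

Let GE (x : R) : 0 < x -> hardy_dual f x = (G x)%:E.
Proof. exact: (hardy_dualE f 1 1 b mf f1 fb ltr01). Qed.

Let tailV (a : R) : 0 < a ->
  (\int[@lebesgue_measure R]_(x in `[a, +oo[) (x `^ (-1 * (q + 1)))%:E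
    = (a `^ (- q) / q)%:E)%E.
Proof.
move=> a0; rewrite integral_powR_tail//; last by rewrite mulN1r ltrN2 ltrDr.
by rewrite (_ : -1 * (q + 1) + 1 = - q) ?opprK//; ring.
Qed.

Let headV (a : R) : 0 < a ->
  (\int[@lebesgue_measure R]_(x in `]0%R, a]) (x `^ (0 * (q + 1)))%:E = a%:E)%E.
Proof.
move=> a0; rewrite mul0r integral_powR_head//.
by rewrite add0r divr1 powRr1// ltW.
Qed.

Let mh := measurable_hardy_poweR f q mf q0.
Let mG := measurable_hardy_dual_poweR f q mf q0.

(** Hf is at most C/x on [[1, +oo[] and 0 before, and equals C/x on [[b, +oo[]; the dual is at least
    C/b on []0, 1]], at most C on []0, b]] and 0 beyond. After division by C, the lower and upper
    bounds on each norm merge as b tends to 1. *)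
Lemma concentrated_function_norms : exists2 C : R, 0 < C &
  [/\ (half_line_norm (q + 1) (hardy f) <= (C * q^-1 `^ (q + 1)^-1)%:E)%E,
      ((C * (b `^ (- q) / q) `^ (q + 1)^-1)%:E <= half_line_norm (q + 1) (hardy f))%E,
      ((C / b)%:E <= half_line_norm (q + 1) (hardy_dual f))%E &
      (half_line_norm (q + 1) (hardy_dual f) <= (C * b `^ (q + 1)^-1)%:E)%E].
Proof.
have powN1 (x : R) : 0 < x -> x `^ (-1) = x^-1.
  by move=> x0; rewrite powR_inv1// ltW.
exists C; first exact: C0.
have posT (a x : R) : 0 < a -> x \in `[a, +oo[ -> 0 < x.
  by move=> a0; rewrite in_itv/= andbT; exact: lt_le_trans.
have posH (a x : R) : x \in `]0, a] -> 0 < x by rewrite in_itv/= => /andP[].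
split.
- have V1 : 0 <= q^-1 :> R by rewrite invr_ge0 ltW.
  have iV := tailV 1 ltr01; rewrite powR1 mul1r in iV.
  apply: (half_line_norm_le_pow _ _ _ _ _ _ p0 (ltW C0) V1 (fun x => posT 1 x ltr01) iV mh).
    move=> x x1; have x0 := posT 1 x ltr01 x1.
    rewrite hE// powN1// !lee_fin divr_ge0 ?(pair_primitive_ge0 PG x0) ?(ltW x0)//=.
    by rewrite ler_pM2r ?invr_gt0// Phi_le.
  move=> x x0; rewrite in_itv/= andbT -ltNge => x1.
  by rewrite hE// Phi_left ?mul0r// ltW.
- have Vb : 0 <= b `^ (- q) / q by rewrite divr_ge0 ?powR_ge0// ltW.
  apply: (half_line_norm_ge_pow _ _ _ _ _ _ p0 (ltW C0) Vb (fun x => posT b x b0) (tailV b b0) mh).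
  move=> x xb; have x0 := posT b x b0 xb; rewrite hE// powN1// lee_fin.
  by rewrite Phi_right//; move: xb; rewrite in_itv/= andbT.
- have Cb : 0 <= C / b by rewrite divr_ge0 ?ltW.
  have := half_line_norm_ge_pow _ 0 _ _ _ _ p0 Cb ler01 (posH 1) (headV 1 ltr01) mG.
  rewrite powR1 mulr1; apply => x x1; have x0 := posH 1 x x1.
  rewrite powRr0 mulr1 GE// lee_fin G_left//; first by case/andP: G1.
  by move: x1; rewrite in_itv/= => /andP[].
- apply: (half_line_norm_le_pow _ 0 _ _ _ _ p0 (ltW C0) (ltW b0) (posH b) (headV b b0) mG).
    move=> x xb; have x0 := posH b x xb.
    by rewrite powRr0 mulr1 GE// !lee_fin (pair_dual_ge0 PG x0) G_le.
  move=> x x0; rewrite in_itv/= x0/= -ltNge => bx.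
  by rewrite GE// G_right// ltW.
Qed.

Lemma concentrated_function_measurable : nonneg_measurable f.
Proof. exact: mf. Qed.

End concentrated_function.

(** * Near-extremals for the constant q *)

Section power_extremals.
Context {R : realType}.
Variable al : R.
Hypothesis al0 : 0 < al.
Hypothesis al1 : al < 1.

(** A common eigenfunction of both operators, with eigenvalues 1/(1 - al) and 1/al; their ratio (1 -
    al)/al is q exactly at al = 1/p. *)
Let phi (t : R) : R := t `^ (- al).

Let mphi : nonneg_measurable phi.
Proof.
split; last by move=> x _; exact: powR_ge0.
apply: measurable_fun_lebesgueType; first exact: measurable_itv.
by apply: measurable_funTS; exact: measurable_powR.
Qed.

Let al1' : 0 < 1 - al. Proof. by rewrite subr_gt0. Qed.

Let hardy_phi (x : R) : 0 < x -> hardy phi x = ((1 - al)^-1 * x `^ (- al))%:E.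
Proof.
move=> x0; rewrite /hardy integral_itv_oo_oc// ge0_integral_lebesgueType.
- rewrite (@integral_powR_head _ x (- al))//; last by rewrite ltrN2.
  rewrite -EFinM addrC (powR_predM _ (1 - al) _ x0); congr EFin.
  rewrite (_ : 1 - al - 1 = - al); last by ring.
  by field; rewrite !gt_eqF.
- exact: measurable_itv.
- by apply/measurable_EFinP; apply: measurable_funTS; exact: measurable_powR.
- by move=> t _; rewrite lee_fin powR_ge0.
Qed.

Let hardy_dual_phi (x : R) : 0 < x -> hardy_dual phi x = (al^-1 * x `^ (- al))%:E.
Proof.
move=> x0; rewrite /hardy_dual.
transitivity (\int[lebesgueR R]_(t in `]x, +oo[) (t `^ (- al - 1))%:E)%E.
  apply: eq_integral => t; rewrite inE/= in_itv/= andbT => xt.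
  have t0 := lt_trans x0 xt.
  by rewrite /phi (powR_predM _ _ _ t0) mulfK// gt_eqF.
rewrite ge0_integral_lebesgueType.
- rewrite integral_itv_obnd_cbnd; last first.
    by apply/measurable_EFinP; apply: measurable_funTS; exact: measurable_powR.
  rewrite (@integral_powR_tail _ x (- al - 1))//; last by rewrite gtrDr oppr_lt0.
  by rewrite subrK opprK mulrC.
- exact: measurable_itv.
- by apply/measurable_EFinP; apply: measurable_funTS; exact: measurable_powR.
- by move=> t _; rewrite lee_fin powR_ge0.
Qed.

Section restriction.
Variable B : interval R.

Definition restricted_power (t : R) : R := \1_([set` B] : set R) t * t `^ (- al).
Local Notation f := restricted_power.

Lemma restricted_power_measurable : nonneg_measurable f.
Proof.
split; last by move=> x _; rewrite mulr_ge0 ?powR_ge0// indicE.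
apply: measurable_funM; last exact: mphi.1.
apply: measurable_fun_lebesgueType; first exact: measurable_itv.
by apply: measurable_indic; exact: measurable_itv.
Qed.

Let f_le t : f t <= phi t.
Proof.
by rewrite /f indicE ler_piMl ?powR_ge0//; case: (_ \in _).
Qed.

Let f_in t : t \in B -> f t = phi t.
Proof. by move=> tB; rewrite /f indicE mem_set ?mul1r. Qed.

Let f_out t : t \notin B -> f t = 0.
Proof. by move=> tB; rewrite /f indicE memNset ?mul0r//; exact/negP. Qed.

Let mf := restricted_power_measurable.

Lemma hardy_restricted_power_le (x : R) :
  0 < x -> (hardy f x <= ((1 - al)^-1 * x `^ (- al))%:E)%E.
Proof.
move=> x0; rewrite -hardy_phi// /hardy lee_wpmul2l ?lee_fin ?invr_ge0 ?(ltW x0)//.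
rewrite !integral_itv_oo_oc//.
by apply: le_integral_itv => // t _ _; exact: f_le.
Qed.

Lemma hardy_dual_restricted_power_le (x : R) :
  0 < x -> (hardy_dual f x <= (al^-1 * x `^ (- al))%:E)%E.
Proof.
move=> x0; rewrite -hardy_dual_phi// /hardy_dual.
have S : [set` `]x, +oo[] `<=` half_line R by apply: subset_half_line; exact: ltW.
apply: ge0_le_integral.
- exact: measurable_itv_lebesgueType.
- move=> t /S /half_line_gt0 t0.
  by rewrite lee_fin divr_ge0 ?mf.2// ltW.
- exact: (nonneg_measurable_sub _ _ (nonneg_measurable_div f mf) S).
- exact: (nonneg_measurable_sub _ _ (nonneg_measurable_div phi mphi) S).
- move=> t /S /half_line_gt0 t0.
  by rewrite lee_fin ler_wpM2r ?invr_ge0 ?(ltW t0)// f_le.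
Qed.

Lemma hardy_restricted_power_in (x : R) : 0 < x -> (forall t, 0 < t -> t < x -> t \in B) ->
  hardy f x = ((1 - al)^-1 * x `^ (- al))%:E.
Proof.
move=> x0 xB; rewrite -hardy_phi// /hardy; congr (_ * _)%E.
by apply: eq_integral => t; rewrite inE/= in_itv/= => /andP[t0 tx]; rewrite f_in// xB.
Qed.

Lemma hardy_restricted_power_out (x : R) :
  (forall t, 0 < t -> t < x -> t \notin B) -> hardy f x = 0%E.
Proof.
move=> xB; rewrite /hardy integral0_eq ?mule0// => t /=.
by rewrite in_itv/= => /andP[t0 tx]; rewrite f_out// xB.
Qed.

Lemma hardy_dual_restricted_power_in (x : R) : 0 < x -> (forall t, x < t -> t \in B) ->
  hardy_dual f x = (al^-1 * x `^ (- al))%:E.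
Proof.
move=> x0 xB; rewrite -hardy_dual_phi// /hardy_dual.
by apply: eq_integral => t; rewrite inE/= in_itv/= andbT => xt; rewrite f_in// xB.
Qed.

Lemma hardy_dual_restricted_power_out (x : R) :
  (forall t, x < t -> t \notin B) -> hardy_dual f x = 0%E.
Proof.
move=> xB; rewrite /hardy_dual integral0_eq// => t /=.
by rewrite in_itv/= andbT => xt; rewrite f_out ?mul0r// xB.
Qed.

End restriction.

Variable q : R.
Hypothesis q0 : 0 < q.

Let p0 : 0 < q + 1. Proof. by rewrite addr_gt0. Qed.
Let Ka : 0 <= al^-1. Proof. by rewrite invr_ge0 ltW. Qed.
Let Kb : 0 <= (1 - al)^-1. Proof. by rewrite invr_ge0 ltW. Qed.

(** Restricting to []0, 1]] keeps Hf an exact power there, while the dual only decreases and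
    vanishes beyond 1. Both estimates involve the same [W], which is finite because al p < 1. *)
Lemma power_head_norms : al * (q + 1) < 1 ->
  exists f : R -> R, nonneg_measurable f /\ exists2 W : R, 0 < W &
    (((1 - al)^-1 * W)%:E <= half_line_norm (q + 1) (hardy f))%E /\
    (half_line_norm (q + 1) (hardy_dual f) <= (al^-1 * W)%:E)%E.
Proof.
move=> alp; pose B : interval R := `]0, 1]; pose f := restricted_power B.
have mf : nonneg_measurable f by exact: restricted_power_measurable.
exists f; split => //; pose V := (1 - al * (q + 1))^-1.
have V0 : 0 < V by rewrite invr_gt0 subr_gt0.
have Bpos x : x \in B -> 0 < x by rewrite in_itv/= => /andP[].
have iV : (\int[@lebesgue_measure R]_(x in [set` B]) (x `^ (- al * (q + 1)))%:E = V%:E)%E.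
  rewrite integral_powR_head ?ltr01//; last by rewrite mulNr ltrN2.
  by rewrite powR1 mul1r /V mulNr addrC.
exists (V `^ (q + 1)^-1); first exact: powR_gt0.
split.
  apply: (half_line_norm_ge_pow _ _ _ _ _ _ p0 Kb (ltW V0) Bpos iV
    (measurable_hardy_poweR f q mf q0)).
  move=> x xB; rewrite hardy_restricted_power_in ?Bpos// => t t0 tx.
  move: xB; rewrite !in_itv/= t0/= => /andP[_]; apply: le_trans; exact: ltW.
apply: (half_line_norm_le_pow _ _ _ _ _ _ p0 Ka (ltW V0) Bpos iV
    (measurable_hardy_dual_poweR f q mf q0)).
  by move=> x /Bpos x0; rewrite hardy_dual_restricted_power_le// hardy_dual_ge0.
move=> x x0; rewrite in_itv/= x0/= -ltNge => x1.
apply: hardy_dual_restricted_power_out => t xt; rewrite in_itv/= negb_and -!ltNge.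
by rewrite (lt_trans x1 xt) orbT.
Qed.

(** Restricting to [[1, +oo[] exchanges the roles: the dual stays an exact power there, and Hf only
    decreases and vanishes before 1. *)
Lemma power_tail_norms : 1 < al * (q + 1) ->
  exists f : R -> R, nonneg_measurable f /\ exists2 W : R, 0 < W &
    (half_line_norm (q + 1) (hardy f) <= ((1 - al)^-1 * W)%:E)%E /\
    ((al^-1 * W)%:E <= half_line_norm (q + 1) (hardy_dual f))%E.
Proof.
move=> alp; pose B : interval R := `[1, +oo[; pose f := restricted_power B.
have mf : nonneg_measurable f by exact: restricted_power_measurable.
exists f; split => //; pose V := (al * (q + 1) - 1)^-1.
have V0 : 0 < V by rewrite invr_gt0 subr_gt0.
have Bpos x : x \in B -> 0 < x by rewrite in_itv/= andbT; exact: lt_le_trans.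
have iV : (\int[@lebesgue_measure R]_(x in [set` B]) (x `^ (- al * (q + 1)))%:E = V%:E)%E.
  rewrite integral_powR_tail ?ltr01//; last by rewrite mulNr ltrN2.
  by rewrite powR1 mul1r /V mulNr opprD opprK.
exists (V `^ (q + 1)^-1); first exact: powR_gt0.
split.
  apply: (half_line_norm_le_pow _ _ _ _ _ _ p0 Kb (ltW V0) Bpos iV
      (measurable_hardy_poweR f q mf q0)).
    by move=> x /Bpos x0; rewrite hardy_restricted_power_le// hardy_ge0.
  move=> x x0; rewrite in_itv/= andbT -ltNge => x1.
  apply: hardy_restricted_power_out => t _ tx; rewrite in_itv/= andbT -ltNge.
  exact: lt_trans x1.
apply: (half_line_norm_ge_pow _ _ _ _ _ _ p0 Ka (ltW V0) Bpos iV
    (measurable_hardy_dual_poweR f q mf q0)).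
move=> x xB; rewrite hardy_dual_restricted_power_in ?Bpos// => t xt.
move: xB; rewrite !in_itv/= !andbT => x1; exact: ltW (le_lt_trans x1 xt).
Qed.

End power_extremals.

(** * Optimality of the constants *)

Section sharp_constants.
Context {R : realType}.
Variables (q c : R).
Hypothesis q0 : 0 < q.
Local Notation N := (half_line_norm (q + 1)).

Lemma half_line_norm_ge0 (p : R) (g : R -> \bar R) : (0 <= half_line_norm p g)%E.
Proof. exact: poweR_ge0. Qed.

Let k : R := q^-1 `^ (q + 1)^-1.

Let k0 : 0 < k. Proof. by rewrite powR_gt0// invr_gt0. Qed.

Let kV : q `^ (q + 1)^-1 = k^-1.
Proof.
by rewrite /k -(powR_inv1 (ltW q0)) -powRrM mulN1r powRN invrK.
Qed.

Let lower_bound_trans (A B : R) (x y : \bar R) :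
  0 <= c -> (A%:E <= x)%E -> (c%:E * x <= y)%E -> (y <= B%:E)%E -> c * A <= B.
Proof.
move=> c0 Ax xy yB; rewrite -lee_fin EFinM.
apply: le_trans yB; apply: le_trans xy.
by rewrite lee_wpmul2l ?lee_fin.
Qed.

(** A negative [c] would make the product with the nonnegative [x] at most 0, hence also the
    positive [B]. *)
Let upper_bound_trans (A B : R) (x y : \bar R) : 0 < B ->
  (0 <= x)%E -> (x <= A%:E)%E -> (y <= c%:E * x)%E -> (B%:E <= y)%E ->
  0 <= c /\ B <= c * A.
Proof.
move=> B0 x0 xA yx By; have [c0|c0] := leP 0 c.
  split => //; rewrite -lee_fin EFinM; apply: le_trans By _; apply: le_trans yx _.
  by rewrite lee_wpmul2l ?lee_fin.
have : (B%:E <= 0)%E.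
  apply: le_trans By _; apply: le_trans yx _.
  by apply: mule_le0_ge0 => //; rewrite lee_fin ltW.
by rewrite lee_fin leNgt B0.
Qed.

Lemma lower_constant_le :
  (forall f : R -> R, nonneg_measurable f ->
     (c%:E * N (hardy f) <= N (hardy_dual f))%E) ->
  c <= q.
Proof.
move=> H; have [c0|c0] := ltP c 0; first by rewrite ltW// (lt_trans c0).
rewrite leNgt; apply/negP => qc.
have q10 : 0 < q + 1 by rewrite addr_gt0.
have c10 : 0 < c + 1 by rewrite ltr_wpDl.
pose u := (c + 1)^-1; pose v := (q + 1)^-1.
have uv : u < v by rewrite ltf_pV2 ?posrE// ltrD2r.
have u0 : 0 < u by rewrite invr_gt0.
have v1 : v < 1 by rewrite invf_lt1// ltrDr.
have uc : u * (c + 1) = 1 by rewrite mulVf// gt_eqF.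
have vq : v * (q + 1) = 1 by rewrite mulVf// gt_eqF.
(* Any exponent strictly between 1/(c + 1) and 1/(q + 1) works: the norms stay finite, while (1 -
   al)/al < c contradicts the assumed inequality. *)
pose al := (u + v) / 2.
have al0 : 0 < al by rewrite /al; lra.
have al1 : al < 1 by rewrite /al; lra.
have alq : al * (q + 1) < 1 by rewrite -[X in _ < X]vq ltr_pM2r// /al; lra.
have alc : 1 < al * (c + 1) by rewrite -[X in X < _]uc ltr_pM2r// /al; lra.
have [f [mf [W W0 [W1 W2]]]] := power_head_norms al al0 al1 q q0 alq.
have := lower_bound_trans _ _ _ _ c0 W1 (H f mf) W2.
rewrite mulrA ler_pM2r// ler_pdivrMr ?subr_gt0// mulrC ler_pdivlMr//.
by lra.
Qed.

Lemma upper_constant_ge :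
  (forall f : R -> R, nonneg_measurable f ->
     (N (hardy_dual f) <= c%:E * N (hardy f))%E) ->
  q <= c.
Proof.
move=> H; have step al (al0 : 0 < al) (al1 : al < 1) : 1 < al * (q + 1) ->
    0 <= c /\ 1 <= al * (c + 1).
  move=> alq; have [f [mf [W W0 [W1 W2]]]] := power_tail_norms al al0 al1 q q0 alq.
  have B0 : 0 < al^-1 * W by rewrite mulr_gt0// invr_gt0.
  have [c0] := upper_bound_trans _ _ _ _ B0 (half_line_norm_ge0 _ _) W1 (H f mf) W2.
  rewrite mulrA ler_pM2r// ler_pdivlMr ?subr_gt0// mulrC ler_pdivrMr// => E.
  by split => //; lra.
have q10 : 0 < q + 1 by rewrite addr_gt0.
have v1 : (q + 1)^-1 < 1 by rewrite invf_lt1// ltrDr.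
have v0 : 0 < (q + 1)^-1 by rewrite invr_gt0.
have vq : (q + 1)^-1 * (q + 1) = 1 by rewrite mulVf// gt_eqF.
set v := (q + 1)^-1 in v0 v1 vq.
have c0 : 0 <= c.
  (* Any exponent strictly between 1/(q + 1) and 1 yields the sign of [c]; it is needed before 1/(c
     + 1) can be compared with 1/(q + 1). *)
  have [] // := step ((v + 1) / 2); [lra|lra|].
  by rewrite -[X in X < _]vq ltr_pM2r//; lra.
rewrite leNgt; apply/negP => cq.
have c10 : 0 < c + 1 by rewrite ltr_wpDl.
pose u := (c + 1)^-1.
have uv : v < u by rewrite ltf_pV2 ?posrE// ltrD2r.
have u1 : u <= 1 by rewrite invf_le1// lerDr.
have uc : u * (c + 1) = 1 by rewrite mulVf// gt_eqF.
have [] := step ((u + v) / 2); [lra|lra| |].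
  by rewrite -[X in X < _]vq ltr_pM2r//; lra.
move=> _; rewrite leNgt => /negP; apply.
by rewrite -[X in _ < X]uc ltr_pM2r//; lra.
Qed.

Lemma upper_constant_ge_root :
  (forall f : R -> R, nonneg_measurable f ->
     (N (hardy_dual f) <= c%:E * N (hardy f))%E) ->
  q `^ (q + 1)^-1 <= c.
Proof.
move=> H; rewrite kV.
have step b : 1 < b -> 0 <= c /\ 1 <= c * k * b.
  move=> b1; have b0 := lt_trans ltr01 b1.
  have [C C0 [h1 _ G1 _]] := concentrated_function_norms b q b1 q0.
  have B0 : 0 < C / b by rewrite divr_gt0.
  have [c0] := upper_bound_trans _ _ _ _ B0 (half_line_norm_ge0 _ _) h1
    (H _ (concentrated_function_measurable b)) G1.
  by rewrite mulrCA ler_pM2l// -/k -[b^-1]div1r ler_pdivrMr.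
have [c0 _] := step 2 (ltr1n _ 2).
have ck0 : 0 <= c * k by rewrite mulr_ge0// ltW.
rewrite -(ler_pM2r k0) mulVf ?gt_eqF// leNgt; apply/negP => ck1.
have s0 : 0 < 1 + c * k by lra.
(* If c k < 1, this b exceeds 1 and yet c k b = 2 c k / (1 + c k) is below 1. *)
have [] := step (2 / (1 + c * k)); first by rewrite ltr_pdivlMr//; lra.
by move=> _; rewrite mulrA ler_pdivlMr//; lra.
Qed.

Lemma lower_constant_le_root :
  (forall f : R -> R, nonneg_measurable f ->
     (c%:E * N (hardy f) <= N (hardy_dual f))%E) ->
  c <= q `^ (q + 1)^-1.
Proof.
move=> H; have [c0|c0] := ltP c 0; first by rewrite ltW// (lt_le_trans c0)// powR_ge0.
have q10 : q + 1 != 0 by rewrite gt_eqF// addr_gt0.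
have step b : 1 < b -> c * k <= b.
  move=> b1; have b0 := lt_trans ltr01 b1.
  have [C C0 [_ h2 _ G2]] := concentrated_function_norms b q b1 q0.
  have := lower_bound_trans _ _ _ _ c0 h2
    (H _ (concentrated_function_measurable b)) G2.
  rewrite mulrCA ler_pM2l// powRM ?powR_ge0 ?invr_ge0 ?(ltW q0)// -/k.
  rewrite -powRrM mulNr powRN mulrCA mulrC ler_pdivrMr ?powR_gt0//.
  rewrite -powRD; last by rewrite (gt_eqF b0) implybT.
  (* The factor b^(1/p) from the dual norm and b^(q/p) from the Hardy norm combine to b itself. *)
  have -> : (q + 1)^-1 + q / (q + 1) = 1 by field.
  by rewrite powRr1// ltW.
rewrite kV -(ler_pM2r k0) mulVf ?gt_eqF// leNgt; apply/negP => ck1.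
(* If c k > 1, the midpoint of 1 and c k is an admissible b smaller than c k. *)
by have := step ((1 + c * k) / 2); lra.
Qed.

End sharp_constants.

(** * From integrals of powers to norms, and the theorem *)

Section hardy_norm_inequality.
Context {R : realType}.
Variables (q : R) (f : R -> R).
Hypothesis q0 : 0 < q.
Hypothesis mf : nonneg_measurable f.
Local Notation N := (half_line_norm (q + 1)).

Let p0 : 0 < q + 1. Proof. by rewrite addr_gt0. Qed.

Let rootK : (q `^ (q + 1)) `^ (q + 1)^-1 = q.
Proof. by rewrite -powRrM mulfV ?gt_eqF// powRr1// ltW. Qed.

Lemma hardy_norm_inequality_le1 : q <= 1 ->
  (q%:E * N (hardy f) <= N (hardy_dual f))%E /\
  (N (hardy_dual f) <= (q `^ (q + 1)^-1)%:E * N (hardy f))%E.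
Proof.
move=> q1; have [J1 J2] := (power_integral_inequality f q mf q0).1 q1; split.
  by rewrite -[q in q%:E]rootK; exact: ge_half_line_norm p0 (powR_ge0 _ _) J2.
exact: le_half_line_norm p0 (ltW q0) J1.
Qed.

Lemma hardy_norm_inequality_ge1 : 1 <= q ->
  ((q `^ (q + 1)^-1)%:E * N (hardy f) <= N (hardy_dual f))%E /\
  (N (hardy_dual f) <= q%:E * N (hardy f))%E.
Proof.
move=> q1; have [J1 J2] := (power_integral_inequality f q mf q0).2 q1; split.
  exact: ge_half_line_norm p0 (ltW q0) J1.
by rewrite -[q in q%:E]rootK; exact: le_half_line_norm p0 (powR_ge0 _ _) J2.
Qed.

End hardy_norm_inequality.

Theorem theorem1p1 (R : realType) (p : R) (p_gt1 : 1 < p) :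
  (p <= 2 ->
    [/\ forall f : R -> R, nonneg_measurable f ->
          ((p - 1)%:E * half_line_norm p (hardy f)
             <= half_line_norm p (hardy_dual f))%E /\
          (half_line_norm p (hardy_dual f)
             <= ((p - 1) `^ p^-1)%:E * half_line_norm p (hardy f))%E,
        forall c : R,
          (forall f : R -> R, nonneg_measurable f ->
             (c%:E * half_line_norm p (hardy f)
                <= half_line_norm p (hardy_dual f))%E) ->
          c <= p - 1
      & forall c : R,
          (forall f : R -> R, nonneg_measurable f ->
             (half_line_norm p (hardy_dual f)
                <= c%:E * half_line_norm p (hardy f))%E) ->
          (p - 1) `^ p^-1 <= c]) /\
  (2 <= p ->
    [/\ forall f : R -> R, nonneg_measurable f ->
          (((p - 1) `^ p^-1)%:E * half_line_norm p (hardy f)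
             <= half_line_norm p (hardy_dual f))%E /\
          (half_line_norm p (hardy_dual f)
             <= (p - 1)%:E * half_line_norm p (hardy f))%E,
        forall c : R,
          (forall f : R -> R, nonneg_measurable f ->
             (c%:E * half_line_norm p (hardy f)
                <= half_line_norm p (hardy_dual f))%E) ->
          c <= (p - 1) `^ p^-1
      & forall c : R,
          (forall f : R -> R, nonneg_measurable f ->
             (half_line_norm p (hardy_dual f)
                <= c%:E * half_line_norm p (hardy f))%E) ->
          p - 1 <= c]).
Proof.
have q0 : 0 < p - 1 by rewrite subr_gt0.
have le2 : (p <= 2) = (p - 1 <= 1) by rewrite lerBlDr.
have ge2 : (2 <= p) = (1 <= p - 1) by rewrite lerBrDr.
rewrite le2 ge2; have -> : p = (p - 1) + 1 by rewrite subrK.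
rewrite addrK; move: (p - 1) q0 => q q0.
split=> q1; split.
- by move=> f mf; exact: hardy_norm_inequality_le1.
- by move=> c; exact: lower_constant_le.
- by move=> c; exact: upper_constant_ge_root.
- by move=> f mf; exact: hardy_norm_inequality_ge1.
- by move=> c; exact: lower_constant_le_root.
- by move=> c; exact: upper_constant_ge.
Qed.
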